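(* Let $g:\mathbb{R}\to(0,\infty)$ be an even real-analytic function. Then the domain $\Omega=\{(x_1,x_2,x_3,x_4)\in\mathbb{R}^4:\sqrt{x_2^2+x_3^2+x_4^2}<g(x_1)\}$ (which is rotationally symmetric about the $x_1$-axis, contains this axis, and has boundary obtained by rotating the graph $\{y=g(x)\}$ about the $x$-axis) is not an exceptional domain.
   Context: A domain $\Omega\subset\mathbb{R}^n$ is exceptional if it admits a roof function: a positive harmonic function $u$ on $\Omega$ with $u=0$ on $\partial\Omega$ and constant normal derivative (normalized to $1$) on $\partial\Omega$. *)

(* Defs.v *)
From Stdlib Require Import Reals Lra.
Open Scope R_scope.

Record R4 := mkR4 { x1 : R; x2 : R; x3 : R; x4 : R }.

Definition add4 (p q : R4) : R4 :=
  mkR4 (x1 p + x1 q) (x2 p + x2 q) (x3 p + x3 q) (x4 p + x4 q).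
Definition sub4 (p q : R4) : R4 :=
  mkR4 (x1 p - x1 q) (x2 p - x2 q) (x3 p - x3 q) (x4 p - x4 q).
Definition scal4 (t : R) (p : R4) : R4 :=
  mkR4 (t * x1 p) (t * x2 p) (t * x3 p) (t * x4 p).
Definition dot4 (p q : R4) : R :=
  x1 p * x1 q + x2 p * x2 q + x3 p * x3 q + x4 p * x4 q.
Definition norm4 (p : R4) : R := sqrt (dot4 p p).
Definition dist4 (p q : R4) : R := norm4 (sub4 p q).

Inductive idx4 := I1 | I2 | I3 | I4.
Definition coord (i : idx4) (p : R4) : R :=
  match i with I1 => x1 p | I2 => x2 p | I3 => x3 p | I4 => x4 p end.
Definition e4 (i : idx4) : R4 :=
  match i with
  | I1 => mkR4 1 0 0 0 | I2 => mkR4 0 1 0 0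
  | I3 => mkR4 0 0 1 0 | I4 => mkR4 0 0 0 1 end.

Definition has_partial (i : idx4) (f : R4 -> R) (p : R4) (l : R) : Prop :=
  derivable_pt_lim (fun t => f (add4 p (scal4 t (e4 i)))) 0 l.

Definition continuous_on4 (S : R4 -> Prop) (f : R4 -> R) : Prop :=
  forall p, S p -> forall eps, 0 < eps -> exists delta, 0 < delta /\
    forall q, S q -> dist4 q p < delta -> Rabs (f q - f p) < eps.

Definition lim_within4 (S : R4 -> Prop) (f : R4 -> R) (p : R4) (l : R) : Prop :=
  forall eps, 0 < eps -> exists delta, 0 < delta /\
    forall q, S q -> dist4 q p < delta -> Rabs (f q - l) < eps.

Definition open4 (S : R4 -> Prop) : Prop :=
  forall p, S p -> exists r, 0 < r /\ forall q, dist4 q p < r -> S q.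

Definition boundary4 (S : R4 -> Prop) (p : R4) : Prop :=
  forall delta, 0 < delta ->
    (exists q, S q /\ dist4 q p < delta) /\ (exists q, ~ S q /\ dist4 q p < delta).

(** [nu] is an outward unit normal to [S] at the boundary point [p]
    (the boundary is differentiable at [p] with tangent hyperplane [nu]^perp,
    [S] lying on the side of [-nu]). *)
Definition outward_unit_normal (S : R4 -> Prop) (p nu : R4) : Prop :=
  norm4 nu = 1 /\
  forall eps, 0 < eps -> exists delta, 0 < delta /\
    forall q, dist4 q p < delta ->
      (dot4 (sub4 q p) nu < - eps * dist4 q p -> S q) /\
      (eps * dist4 q p < dot4 (sub4 q p) nu -> ~ S q).

(** Roof function: [u] positive and harmonic (C^2, zero Laplacian) on [Om],
    [u] extends continuously by 0 to the boundary, the gradient of [u] extends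
    continuously to the closure, and the inward normal derivative equals 1 on
    the boundary. [Du i] is the i-th partial derivative, [D2u i j] = d_j d_i u. *)
Definition roof_function (Om : R4 -> Prop) (u : R4 -> R) : Prop :=
  exists (Du : idx4 -> R4 -> R) (D2u : idx4 -> idx4 -> R4 -> R),
    (forall p, Om p -> 0 < u p) /\
    (forall i p, Om p -> has_partial i u p (Du i p)) /\
    (forall i j p, Om p -> has_partial j (Du i) p (D2u i j p)) /\
    (forall i, continuous_on4 Om (Du i)) /\
    (forall i j, continuous_on4 Om (D2u i j)) /\
    (forall p, Om p -> D2u I1 I1 p + D2u I2 I2 p + D2u I3 I3 p + D2u I4 I4 p = 0) /\
    (forall p, boundary4 Om p ->
       lim_within4 Om u p 0 /\
       exists L : idx4 -> R,
         (forall i, lim_within4 Om (Du i) p (L i)) /\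
         forall nu, outward_unit_normal Om p nu ->
           - (L I1 * x1 nu + L I2 * x2 nu + L I3 * x3 nu + L I4 * x4 nu) = 1).

(** Exceptional domain (the domains considered are open and connected). *)
Definition exceptional (Om : R4 -> Prop) : Prop :=
  exists u, roof_function Om u.

Definition real_analytic (g : R -> R) : Prop :=
  forall x0, exists r, 0 < r /\ exists a : nat -> R,
    forall x, Rabs (x - x0) < r ->
      Un_cv (fun N => sum_f_R0 (fun n => a n * (x - x0) ^ n) N) (g x).

Definition even_fun (g : R -> R) : Prop := forall x, g (- x) = g x.

Definition rot_domain (g : R -> R) (p : R4) : Prop :=
  sqrt (x2 p ^ 2 + x3 p ^ 2 + x4 p ^ 2) < g (x1 p).

(* Main.v *)
(** If [u] is a roof function, let [U] be [u] extended by zero. Balls inside [Om]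
    that touch the boundary, where the slope of [U] is one, force
    [U p <= C dist(p, complement)] (Hopf's lemma, with a weighted maximum instead
    of Harnack's inequality), so the gradient of [U] is bounded. As [Om] avoids
    the hyperplane [x1 = 0] outside a bounded set, it carries a positive
    superharmonic function tending to infinity, and Phragmen-Lindelof upgrades this
    to [|grad U| <= 1]: [U] is 1-Lipschitz. Hence [U] lies below the distance to the
    boundary; if the mean curvature of the boundary were positive at a point, that
    distance would be strictly superharmonic there and the slope of [U] smaller than
    one. So the complement of [Om] is mean convex, which for the rotated graph reads
    [g g'' >= 2 (1 + g'^2)]; but then [(g'/g^2)' > 0] and [g] blows up in finite time. *)

From Coquelicot Require Import Coquelicot.
From Stdlib Require Import Reals Lra Psatz List Classical ClassicalEpsilon.
Require Import Defs.
Open Scope R_scope.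

(** Harmonicity enters through a single fact: at a local maximum the Laplacian is not positive.
    Every estimate is therefore a comparison with an explicit function whose Laplacian is computed
    by the rules for [jet]. The obstacle is that nothing limits the growth of [g], so [Om] may fill
    most of the space away from the hyperplane. On the whole space no superharmonic function tends
    to infinity, by the minimum principle, and [ln (1 + dot4 p p)] alone has positive Laplacian. The
    logarithm of [1 + x1 ^ 2], superharmonic for [|x1| > 1], repairs this off a slab, and in the
    slab [Om] is bounded. The Hopf constant must be the same for all balls, whatever their radius,
    since only then does the linear bound give a bounded gradient, which the logarithmic growth of
    the barrier can absorb. The distance to the boundary is never differentiated: at a boundary
    point it is replaced by a quadratic function whose curvatures are slightly smaller than those of
    the boundary. *)

(** * Euclidean space, continuity and compactness *)

Notation ray p t e := (add4 p (scal4 t e)).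

Lemma R4_eq (p q : R4) :
  x1 p = x1 q -> x2 p = x2 q -> x3 p = x3 q -> x4 p = x4 q -> p = q.
Proof. destruct p, q; cbn; congruence. Qed.

Ltac r4eq := apply R4_eq; cbn; try ring.

Lemma dot4_pos p : 0 <= dot4 p p.
Proof. unfold dot4; nra. Qed.

Lemma norm4_pos p : 0 <= norm4 p.
Proof. apply sqrt_pos. Qed.

Lemma norm4_sqr p : norm4 p * norm4 p = dot4 p p.
Proof. apply sqrt_sqrt, dot4_pos. Qed.

Lemma norm4_le p r : 0 <= r -> dot4 p p <= r * r -> norm4 p <= r.
Proof.
  intros Hr H. rewrite <- (sqrt_square r Hr). now apply sqrt_le_1_alt.
Qed.

Lemma cauchy_schwarz4 p q : Rabs (dot4 p q) <= norm4 p * norm4 q.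
Proof.
  assert (H : dot4 p q * dot4 p q <= (norm4 p * norm4 q) * (norm4 p * norm4 q)).
  { replace (norm4 p * norm4 q * (norm4 p * norm4 q))
      with ((norm4 p * norm4 p) * (norm4 q * norm4 q)) by ring.
    rewrite !norm4_sqr. unfold dot4. destruct p as [a b c d], q as [a' b' c' d']; cbn.
    apply Rminus_le.
    replace (_ - _) with
      (- ((a*b'-b*a')^2 + (a*c'-c*a')^2 + (a*d'-d*a')^2
         + (b*c'-c*b')^2 + (b*d'-d*b')^2 + (c*d'-d*c')^2)) by ring.
    pose proof (pow2_ge_0 (a*b'-b*a')); pose proof (pow2_ge_0 (a*c'-c*a'));
    pose proof (pow2_ge_0 (a*d'-d*a')); pose proof (pow2_ge_0 (b*c'-c*b'));
    pose proof (pow2_ge_0 (b*d'-d*b')); pose proof (pow2_ge_0 (c*d'-d*c')). lra. }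
  pose proof (norm4_pos p). pose proof (norm4_pos q).
  assert (0 <= norm4 p * norm4 q) by nra.
  apply Rabs_le. split; nra.
Qed.

Lemma norm4_add p q : norm4 (add4 p q) <= norm4 p + norm4 q.
Proof.
  pose proof (norm4_pos p). pose proof (norm4_pos q).
  apply norm4_le; [lra|].
  replace (dot4 (add4 p q) (add4 p q)) with (dot4 p p + 2 * dot4 p q + dot4 q q)
    by (unfold dot4; cbn; ring).
  pose proof (cauchy_schwarz4 p q) as H1. apply Rabs_le_between in H1.
  rewrite <- (norm4_sqr p), <- (norm4_sqr q). nra.
Qed.

Lemma dist4_sym p q : dist4 p q = dist4 q p.
Proof. unfold dist4, norm4. f_equal. unfold dot4; cbn; ring. Qed.

Lemma dist4_tri p q r : dist4 p r <= dist4 p q + dist4 q r.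
Proof.
  unfold dist4. replace (sub4 p r) with (add4 (sub4 p q) (sub4 q r)) by r4eq.
  apply norm4_add.
Qed.

Lemma dist4_pos p q : 0 <= dist4 p q.
Proof. apply norm4_pos. Qed.

Lemma dist4_refl p : dist4 p p = 0.
Proof.
  unfold dist4, norm4.
  replace (dot4 _ _) with 0 by (unfold dot4; cbn; ring). apply sqrt_0.
Qed.

Lemma norm4_scal t e : norm4 (scal4 t e) = Rabs t * norm4 e.
Proof.
  unfold norm4.
  replace (dot4 (scal4 t e) (scal4 t e)) with (Rsqr t * dot4 e e)
    by (unfold dot4, Rsqr; cbn; ring).
  rewrite sqrt_mult_alt by apply Rle_0_sqr. now rewrite sqrt_Rsqr_abs.
Qed.

Lemma dist4_ray p t e : dist4 (ray p t e) p = Rabs t * norm4 e.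
Proof.
  unfold dist4. replace (sub4 (ray p t e) p) with (scal4 t e) by r4eq.
  apply norm4_scal.
Qed.

Lemma dist4_ray2 p s t e : dist4 (ray p s e) (ray p t e) = Rabs (s - t) * norm4 e.
Proof.
  unfold dist4. replace (sub4 (ray p s e) (ray p t e)) with (scal4 (s - t) e) by r4eq.
  apply norm4_scal.
Qed.

Lemma ray0 p e : ray p 0 e = p.
Proof. r4eq. Qed.

Lemma ray_ray p s t e : ray (ray p s e) t e = ray p (s + t) e.
Proof. r4eq. Qed.

Lemma norm4_e4 i : norm4 (e4 i) = 1.
Proof.
  unfold norm4. replace (dot4 _ _) with 1 by (destruct i; unfold dot4; cbn; ring).
  apply sqrt_1.
Qed.

Lemma coord_le_norm4 i p : Rabs (coord i p) <= norm4 p.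
Proof.
  replace (coord i p) with (dot4 p (e4 i)) by (destruct i; unfold dot4; cbn; ring).
  eapply Rle_trans; [apply cauchy_schwarz4|]. rewrite norm4_e4. lra.
Qed.

Lemma dist4_sum_coord p q :
  dist4 p q <= Rabs (x1 p - x1 q) + Rabs (x2 p - x2 q)
               + Rabs (x3 p - x3 q) + Rabs (x4 p - x4 q).
Proof.
  unfold dist4. set (d := sub4 p q).
  replace d with (add4 (add4 (scal4 (x1 d) (e4 I1)) (scal4 (x2 d) (e4 I2)))
    (add4 (scal4 (x3 d) (e4 I3)) (scal4 (x4 d) (e4 I4)))) by r4eq.
  eapply Rle_trans; [apply norm4_add|].
  pose proof (norm4_add (scal4 (x1 d) (e4 I1)) (scal4 (x2 d) (e4 I2))).
  pose proof (norm4_add (scal4 (x3 d) (e4 I3)) (scal4 (x4 d) (e4 I4))).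
  rewrite !norm4_scal, !norm4_e4 in *. subst d; cbn in *. lra.
Qed.

Definition cont4 (f : R4 -> R) (p : R4) : Prop :=
  forall eps, 0 < eps -> exists delta, 0 < delta /\
    forall q, dist4 q p < delta -> Rabs (f q - f p) < eps.

Lemma cont4_const c p : cont4 (fun _ => c) p.
Proof. intros eps H. exists 1. split; [lra|]. intros. rewrite Rminus_diag, Rabs_R0; lra. Qed.

Lemma cont4_coord i p : cont4 (coord i) p.
Proof.
  intros eps H. exists eps. split; [lra|]. intros q Hq.
  eapply Rle_lt_trans; [|exact Hq].
  replace (coord i q - coord i p) with (coord i (sub4 q p)) by (destruct i; easy).
  apply coord_le_norm4.
Qed.

Lemma cont4_comp (phi : R -> R) f p :
  continuity_pt phi (f p) -> cont4 f p -> cont4 (fun q => phi (f q)) p.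
Proof.
  intros H Hf eps He. destruct (H eps He) as (a & Ha & H1).
  destruct (Hf a Ha) as (d & Hd & H2). exists d. split; [easy|]. intros q Hq.
  destruct (Req_dec (f q) (f p)) as [E|E].
  - rewrite E, Rminus_diag, Rabs_R0; lra.
  - apply (H1 (f q)). split; [split; [easy|congruence]|]. now apply H2.
Qed.

Lemma cont4_plus f g p : cont4 f p -> cont4 g p -> cont4 (fun q => f q + g q) p.
Proof.
  intros Hf Hg eps He.
  destruct (Hf (eps/2)) as (a & Ha & H1); [lra|].
  destruct (Hg (eps/2)) as (b & Hb & H2); [lra|].
  exists (Rmin a b). split; [now apply Rmin_pos|]. intros q Hq.
  specialize (H1 q (Rlt_le_trans _ _ _ Hq (Rmin_l _ _))).
  specialize (H2 q (Rlt_le_trans _ _ _ Hq (Rmin_r _ _))).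
  apply Rabs_def2 in H1; apply Rabs_def2 in H2. apply Rabs_def1; lra.
Qed.

Lemma cont4_scal c f p : cont4 f p -> cont4 (fun q => c * f q) p.
Proof.
  intros H. apply (cont4_comp (fun x => c * x) f p); [|easy].
  apply derivable_continuous_pt, derivable_pt_scal, derivable_pt_id.
Qed.

Lemma cont4_opp f p : cont4 f p -> cont4 (fun q => - f q) p.
Proof.
  intros H. apply (cont4_comp (fun x => - x) f p); [|easy].
  apply derivable_continuous_pt, derivable_pt_opp, derivable_pt_id.
Qed.

Lemma cont4_minus f g p : cont4 f p -> cont4 g p -> cont4 (fun q => f q - g q) p.
Proof. intros Hf Hg. apply (cont4_plus f (fun q => - g q)); [easy|now apply cont4_opp]. Qed.

Lemma cont4_ext f g p : (forall q, f q = g q) -> cont4 f p -> cont4 g p.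
Proof.
  intros E H eps He. destruct (H eps He) as (d & Hd & H1). exists d. split; [easy|].
  intros q Hq. rewrite <- !E. now apply H1.
Qed.

(** Polarization reduces the product to squares, which [cont4_comp] handles. *)
Lemma cont4_mult f g p : cont4 f p -> cont4 g p -> cont4 (fun q => f q * g q) p.
Proof.
  intros Hf Hg.
  apply cont4_ext with (fun q => /4 * ((f q + g q) * (f q + g q)) - /4 * ((f q - g q) * (f q - g q)));
    [intros; field|].
  assert (S : forall h, cont4 h p -> cont4 (fun q => h q * h q) p).
  { intros h Hh. apply (cont4_comp (fun x => x * x) h p); [|easy].
    apply derivable_continuous_pt, derivable_pt_mult; apply derivable_pt_id. }
  apply cont4_minus; apply cont4_scal, S; [now apply cont4_plus|now apply cont4_minus].
Qed.

Lemma cont4_pow n f p : cont4 f p -> cont4 (fun q => f q ^ n) p.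
Proof.
  intros H. induction n as [|n IH]; cbn; [apply cont4_const|now apply cont4_mult].
Qed.

Lemma cont4_inv f p : f p <> 0 -> cont4 f p -> cont4 (fun q => / f q) p.
Proof.
  intros H0 H. apply (cont4_comp Rinv f p); [|easy].
  apply (continuity_pt_inv (fun x => x)); [|easy].
  apply derivable_continuous_pt, derivable_pt_id.
Qed.

Lemma cont4_div f g p : g p <> 0 -> cont4 f p -> cont4 g p -> cont4 (fun q => f q / g q) p.
Proof. intros H0 Hf Hg. apply cont4_mult; [easy|now apply cont4_inv]. Qed.

Lemma cont4_dist a p : cont4 (fun q => dist4 q a) p.
Proof.
  intros eps He. exists eps. split; [easy|]. intros q Hq.
  pose proof (dist4_tri q p a). pose proof (dist4_tri p q a).
  rewrite (dist4_sym p q) in *. apply Rabs_def1; lra.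
Qed.

Lemma cont4_pre f g p :
  (forall q r, dist4 (g q) (g r) <= dist4 q r) ->
  cont4 f (g p) -> cont4 (fun q => f (g q)) p.
Proof.
  intros Hg Hf eps He. destruct (Hf eps He) as (d & Hd & H). exists d. split; [easy|].
  intros q Hq. apply H. eapply Rle_lt_trans; [apply Hg|easy].
Qed.

Ltac cont4_step :=
  match goal with
  | |- cont4 (fun _ => ?c) _ => apply cont4_const
  | |- cont4 (coord ?i) _ => apply (cont4_coord i)
  | |- cont4 x1 _ => apply (cont4_coord I1)
  | |- cont4 x2 _ => apply (cont4_coord I2)
  | |- cont4 x3 _ => apply (cont4_coord I3)
  | |- cont4 x4 _ => apply (cont4_coord I4)
  | |- cont4 (fun q => x1 q) _ => apply (cont4_coord I1)
  | |- cont4 (fun q => x2 q) _ => apply (cont4_coord I2)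
  | |- cont4 (fun q => x3 q) _ => apply (cont4_coord I3)
  | |- cont4 (fun q => x4 q) _ => apply (cont4_coord I4)
  | |- cont4 (fun q => coord ?i q) _ => apply (cont4_coord i)
  | |- cont4 (fun q => _ + _) _ => apply cont4_plus
  | |- cont4 (fun q => _ - _) _ => apply cont4_minus
  | |- cont4 (fun q => - _) _ => apply cont4_opp
  | |- cont4 (fun q => _ * _) _ => apply cont4_mult
  | |- cont4 (fun q => _ / _) _ => apply cont4_div
  | |- cont4 (fun q => / _) _ => apply cont4_inv
  | |- cont4 (fun q => _ ^ _) _ => apply cont4_pow
  | |- cont4 (fun q => dist4 q _) _ => apply cont4_dist
  end.

(** Points as nested tuples, the format in which [compactness_list] is stated. *)
Definition tn4 (p : R4) : Tn 4 R := (x1 p, (x2 p, (x3 p, (x4 p, tt)))).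
Definition nt4 (t : Tn 4 R) : R4 :=
  let '(a, (b, (c, (d, _)))) := t in mkR4 a b c d.

Lemma compact_cover (Rad : R) (delta : R4 -> R) :
  (forall p, 0 < delta p) ->
  exists l, forall p, norm4 p <= Rad -> exists c, In c l /\ dist4 p c < delta c.
Proof.
  intros Hd.
  (* Closeness of tuples is coordinatewise and the distance is at most the sum of four coordinate
     distances, hence a quarter of [delta]. *)
  assert (Hd' : forall t : Tn 4 R, 0 < delta (nt4 t) / 4)
    by (intros t; specialize (Hd (nt4 t)); lra).
  destruct (NNPP _ (compactness_list 4 (tn4 (mkR4 (-Rad) (-Rad) (-Rad) (-Rad)))
    (tn4 (mkR4 Rad Rad Rad Rad)) (fun t => mkposreal _ (Hd' t)))) as (l & Hl).
  exists (map nt4 l). intros p Hp.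
  assert (C : forall i, - Rad <= coord i p <= Rad).
  { intros i. pose proof (coord_le_norm4 i p). apply Rabs_le_between. lra. }
  destruct (Hl (tn4 p)) as (t & Ht & _ & Hc).
  { pose proof (C I1); pose proof (C I2); pose proof (C I3); pose proof (C I4).
    cbn in *. repeat split; lra. }
  exists (nt4 t). split; [now apply in_map|].
  destruct t as (a & b & c & d & []). cbn in Hc. destruct Hc as (H1 & H2 & H3 & H4 & _).
  eapply Rle_lt_trans; [apply dist4_sum_coord|]. cbn in *. lra.
Qed.

Lemma list_argmax (A : Type) (f : A -> R) (l : list A) :
  l <> nil -> exists a, In a l /\ forall b, In b l -> f b <= f a.
Proof.
  induction l as [|a l IH]; [easy|]. intros _.
  destruct l as [|a' l'].
  - exists a. split; [now left|]. intros b [->|[]]. lra.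
  - destruct IH as (m & Hm & H); [easy|].
    destruct (Rle_lt_dec (f a) (f m)) as [Hle|Hlt].
    + exists m. split; [now right|]. intros b [<-|Hb]; [easy|now apply H].
    + exists a. split; [now left|]. intros b [<-|Hb]; [lra|].
      specialize (H b Hb). lra.
Qed.

Definition closed4 (K : R4 -> Prop) : Prop := open4 (fun p => ~ K p).

(** Without a maximum, each point has a neighbourhood on which [f] stays below its value at one
    fixed point of [K]. In a finite cover the largest of these finitely many values would again be
    exceeded by one of them. *)
Lemma max_attained (K : R4 -> Prop) (Rad : R) (f : R4 -> R) (p0 : R4) :
  closed4 K -> (forall p, K p -> norm4 p <= Rad) -> K p0 ->
  (forall p, K p -> cont4 f p) ->
  exists m, K m /\ forall p, K p -> f p <= f m.
Proof.
  intros HK HR H0 Hc. apply NNPP; intros Hno.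
  assert (Hbig : forall p, K p -> exists p', K p' /\ f p < f p').
  { intros p Hp. apply NNPP; intros Hn. apply Hno. exists p. split; [easy|].
    intros q Hq. apply Rnot_lt_le; intros Hlt. apply Hn. now exists q. }
  assert (Hloc : forall p, exists dp : R * R4, 0 < fst dp /\ K (snd dp) /\
      forall q, dist4 q p < fst dp -> K q -> f q < f (snd dp)).
  { intros p. destruct (classic (K p)) as [Hp|Hp].
    - destruct (Hbig p Hp) as (p' & Hp' & Hlt).
      destruct (Hc p Hp (f p' - f p)) as (d & Hd & H); [lra|].
      exists (d, p'). cbn. repeat split; try easy. intros q Hq _.
      specialize (H q Hq). apply Rabs_def2 in H. lra.
    (* Here the neighbourhood misses [K], so [p0] is a placeholder. *)
    - destruct (HK p Hp) as (r & Hr & H). exists (r, p0). cbn.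
      repeat split; try easy. intros q Hq HKq. now destruct (H q Hq). }
  set (F := fun p => proj1_sig (constructive_indefinite_description _ (Hloc p))).
  assert (HF : forall p, 0 < fst (F p) /\ K (snd (F p)) /\
      forall q, dist4 q p < fst (F p) -> K q -> f q < f (snd (F p))).
  { intros p. unfold F. now destruct (constructive_indefinite_description _ (Hloc p)). }
  destruct (compact_cover Rad (fun p => fst (F p)) (fun p => proj1 (HF p))) as (l & Hl).
  destruct (list_argmax _ (fun c => f (snd (F c))) l) as (c & Hc1 & Hc2).
  { destruct (Hl p0 (HR _ H0)) as (c & Hc' & _). intros ->. easy. }
  destruct (HF c) as (_ & HKc & _).
  destruct (Hl (snd (F c)) (HR _ HKc)) as (b & Hb1 & Hb2).
  destruct (HF b) as (_ & _ & HH). specialize (HH _ Hb2 HKc).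
  specialize (Hc2 b Hb1). lra.
Qed.

Lemma closed4_and K L : closed4 K -> closed4 L -> closed4 (fun p => K p /\ L p).
Proof.
  intros HK HL p Hp.
  destruct (classic (K p)) as [H|H].
  - destruct (HL p) as (r & Hr & H'); [tauto|]. exists r. split; [easy|].
    intros q Hq [_ Hl]. now apply (H' q Hq).
  - destruct (HK p H) as (r & Hr & H'). exists r. split; [easy|].
    intros q Hq [Hl _]. now apply (H' q Hq).
Qed.

Lemma closed4_ge (f : R4 -> R) c : (forall p, cont4 f p) -> closed4 (fun p => c <= f p).
Proof.
  intros Hf p Hp. destruct (Hf p (c - f p)) as (d & Hd & H); [lra|].
  exists d. split; [easy|]. intros q Hq. specialize (H q Hq). apply Rabs_def2 in H. lra.
Qed.

Lemma closed4_le (f : R4 -> R) c : (forall p, cont4 f p) -> closed4 (fun p => f p <= c).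
Proof.
  intros Hf p Hp. destruct (Hf p (f p - c)) as (d & Hd & H); [lra|].
  exists d. split; [easy|]. intros q Hq. specialize (H q Hq). apply Rabs_def2 in H. lra.
Qed.

Lemma norm4_ball_bound p a d : dist4 p a <= d -> norm4 p <= d + norm4 a.
Proof.
  intros H. replace p with (add4 (sub4 p a) a) by r4eq.
  eapply Rle_trans; [apply norm4_add|]. unfold dist4 in H. lra.
Qed.

(** * Second derivatives along lines and the maximum principle *)

Definition has2 (f : R4 -> R) (p e : R4) (l : R) : Prop :=
  exists f' d, 0 < d /\
    (forall t, Rabs t < d -> derivable_pt_lim (fun s => f (ray p s e)) t (f' t)) /\
    derivable_pt_lim f' 0 l.

(** A relation that looks at [f] only on the four axis-parallel lines through [p]; it applies alike
    to explicit functions, to roof functions extended by zero, and to their translates and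
    reflections. *)
Definition lap (f : R4 -> R) (p : R4) (l : R) : Prop :=
  exists m : idx4 -> R, (forall i, has2 f p (e4 i) (m i)) /\
    m I1 + m I2 + m I3 + m I4 = l.

Definition local_max (f : R4 -> R) (p : R4) : Prop :=
  exists r, 0 < r /\ forall q, dist4 q p < r -> f q <= f p.

Lemma second_derivative_test (f f' : R -> R) (d l : R) :
  0 < d -> (forall t, Rabs t < d -> derivable_pt_lim f t (f' t)) ->
  derivable_pt_lim f' 0 l -> (forall t, Rabs t < d -> f t <= f 0) -> l <= 0.
Proof.
  intros Hd Hf Hl Hm. apply Rnot_lt_le; intros Hpos.
  assert (H0 : f' 0 = 0).
  { assert (Hd0 : derivable_pt_lim f 0 (f' 0)) by (apply Hf; rewrite Rabs_R0; lra).
    pose (pr := exist _ (f' 0) Hd0 : derivable_pt f 0).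
    change (derive_pt f 0 pr = 0). apply (deriv_maximum f (-d) d); try lra.
    intros x H1 H2. apply Hm. apply Rabs_def1; lra. }
  destruct (Hl (l / 2)) as ([a Ha] & H); [lra|]. cbn in H.
  set (t := Rmin (d / 2) (a / 2)).
  assert (Ht : 0 < t) by (apply Rmin_pos; lra).
  assert (Htd : t <= d / 2) by apply Rmin_l.
  assert (Hta : t <= a / 2) by apply Rmin_r.
  destruct (MVT_cor2 f f' 0 t Ht) as (c & Hc & Hc1 & Hc2).
  { intros c Hc. apply Hf. apply Rabs_def1; lra. }
  assert (Hfc : 0 < f' c).
  { specialize (H c). rewrite Rplus_0_l, H0, Rminus_0_r in H.
    assert (Hq : Rabs (f' c / c - l) < l / 2) by (apply H; [lra|apply Rabs_def1; lra]).
    apply Rabs_def2 in Hq.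
    replace (f' c) with (f' c / c * c) by (field; lra).
    apply Rmult_lt_0_compat; lra. }
  assert (f t <= f 0) by (apply Hm; apply Rabs_def1; lra).
  nra.
Qed.

Lemma has2_local_max f p e l : norm4 e = 1 -> local_max f p -> has2 f p e l -> l <= 0.
Proof.
  intros He (r & Hr & Hm) (f' & d & Hd & H1 & H2).
  apply (second_derivative_test (fun s => f (ray p s e)) f' (Rmin d r) l).
  - now apply Rmin_pos.
  - intros t Ht. apply H1. eapply Rlt_le_trans; [exact Ht|apply Rmin_l].
  - easy.
  - intros t Ht. rewrite ray0. apply Hm. rewrite dist4_ray, He, Rmult_1_r.
    eapply Rlt_le_trans; [exact Ht|apply Rmin_r].
Qed.

(** The maximum principle as it is used below: a difference with positive Laplacian has no local
    maximum, so its maximum over a compact set lies where the boundary comparison decides. *)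
Lemma lap_local_max f p l : local_max f p -> lap f p l -> l <= 0.
Proof.
  intros Hm (m & H & <-).
  pose proof (fun i => has2_local_max f p (e4 i) (m i) (norm4_e4 i) Hm (H i)) as Hi.
  pose proof (Hi I1); pose proof (Hi I2); pose proof (Hi I3); pose proof (Hi I4). lra.
Qed.

Lemma has2_plus f g p e l m :
  has2 f p e l -> has2 g p e m -> has2 (fun q => f q + g q) p e (l + m).
Proof.
  intros (f' & d & Hd & H1 & H2) (g' & d' & Hd' & H1' & H2').
  exists (fun t => f' t + g' t), (Rmin d d'). split; [now apply Rmin_pos|]. split.
  - intros t Ht. apply (derivable_pt_lim_plus (fun s => f (ray p s e)) (fun s => g (ray p s e))).
    + apply H1. eapply Rlt_le_trans; [exact Ht|apply Rmin_l].
    + apply H1'. eapply Rlt_le_trans; [exact Ht|apply Rmin_r].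
  - now apply (derivable_pt_lim_plus f' g').
Qed.

Lemma has2_scal c f p e l : has2 f p e l -> has2 (fun q => c * f q) p e (c * l).
Proof.
  intros (f' & d & Hd & H1 & H2). exists (fun t => c * f' t), d.
  split; [easy|]. split.
  - intros t Ht. now apply (derivable_pt_lim_scal (fun s => f (ray p s e))), H1.
  - now apply derivable_pt_lim_scal.
Qed.

Lemma lap_plus f g p l m : lap f p l -> lap g p m -> lap (fun q => f q + g q) p (l + m).
Proof.
  intros (a & Ha & <-) (b & Hb & <-). exists (fun i => a i + b i).
  split; [intros i; now apply has2_plus|ring].
Qed.

Lemma lap_scal c f p l : lap f p l -> lap (fun q => c * f q) p (c * l).
Proof.
  intros (a & Ha & <-). exists (fun i => c * a i).
  split; [intros i; now apply has2_scal|ring].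
Qed.

Lemma has2_ext f g p e l : (forall q, f q = g q) -> has2 f p e l -> has2 g p e l.
Proof.
  intros E (f' & d & Hd & H1 & H2). exists f', d. split; [easy|]. split; [|easy].
  intros t Ht. apply is_derive_Reals. apply is_derive_ext with (fun s => f (ray p s e)).
  - intros; apply E.
  - now apply is_derive_Reals, H1.
Qed.

Lemma lap_ext f g p l : (forall q, f q = g q) -> lap f p l -> lap g p l.
Proof.
  intros E (a & Ha & <-). exists a. split; [|easy]. intros i. now apply has2_ext with f.
Qed.

Lemma lap_eq f p l m : lap f p l -> l = m -> lap f p m.
Proof. now intros H <-. Qed.

Lemma lap_minus f g p l m : lap f p l -> lap g p m -> lap (fun q => f q - g q) p (l - m).
Proof.
  intros Hf Hg. apply lap_eq with (l + -1 * m); [|ring].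
  apply lap_ext with (fun q => f q + -1 * g q); [intros; ring|].
  apply lap_plus; [easy|now apply lap_scal].
Qed.

(** * Differentiability of roof functions *)

Definition grad (Du : idx4 -> R4 -> R) (p : R4) : R4 :=
  mkR4 (Du I1 p) (Du I2 p) (Du I3 p) (Du I4 p).

(** Working form of a roof function: extended by zero, it is continuous everywhere, so maxima over
    compact sets reaching beyond [Om] exist. The field [roof_normal] keeps the quantifier over
    normals in [roof_bdry] from being vacuous. *)
Record roof (Om : R4 -> Prop) (U : R4 -> R) (Du : idx4 -> R4 -> R) : Prop := {
  roof_open : open4 Om;
  roof_cont : forall p, cont4 U p;
  roof_pos : forall p, Om p -> 0 < U p;
  roof_zero : forall p, ~ Om p -> U p = 0;
  roof_part : forall i p, Om p -> has_partial i U p (Du i p);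
  roof_cont1 : forall i p, Om p -> cont4 (Du i) p;
  roof_lap : forall p, Om p -> lap U p 0;
  roof_normal : forall q, boundary4 Om q -> exists nu, outward_unit_normal Om q nu;
  roof_bdry : forall q, boundary4 Om q -> exists L,
    (forall i, lim_within4 Om (Du i) q (coord i L)) /\
    forall nu, outward_unit_normal Om q nu -> dot4 L nu = -1 }.

Lemma roof_nonneg Om U Du p : roof Om U Du -> 0 <= U p.
Proof.
  intros H. destruct (classic (Om p)) as [Hp|Hp].
  - now apply Rlt_le, (roof_pos _ _ _ H).
  - rewrite (roof_zero _ _ _ H p Hp). lra.
Qed.

Lemma cont_ray f p e s : cont4 f (ray p s e) -> continuity_pt (fun t => f (ray p t e)) s.
Proof.
  intros H eps He. destruct (H eps He) as (d & Hd & H1).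
  pose proof (norm4_pos e) as Hn.
  exists (d / (norm4 e + 1)). split; [apply Rdiv_lt_0_compat; lra|].
  intros t [_ Ht]. cbn in *. unfold Rdist in *. apply H1. rewrite dist4_ray2.
  assert (Hlt : Rabs (t - s) * (norm4 e + 1) < d).
  { apply Rmult_lt_reg_r with (/ (norm4 e + 1)); [apply Rinv_0_lt_compat; lra|].
    rewrite Rmult_assoc, Rinv_r, Rmult_1_r by lra. exact Ht. }
  pose proof (Rabs_pos (t - s)). nra.
Qed.

Lemma has_partial_ray i f p t l :
  has_partial i f (ray p t (e4 i)) l ->
  derivable_pt_lim (fun s => f (ray p s (e4 i))) t l.
Proof.
  intros H eps He. destruct (H eps He) as (d & Hd). exists d. intros h Hh Hh'.
  specialize (Hd h Hh Hh'). rewrite !ray_ray in Hd.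
  now rewrite Rplus_0_l, Rplus_0_r in Hd.
Qed.

Section ContinuouslyDifferentiable.

Context (Om : R4 -> Prop) (U : R4 -> R) (Du : idx4 -> R4 -> R).
Context (Hopen : open4 Om).
Context (Hpart : forall i p, Om p -> has_partial i U p (Du i p)).
Context (Hcont1 : forall i p, Om p -> cont4 (Du i) p).

Lemma partial_step i p r c eps a v :
  (forall q, dist4 q p < r -> Om q /\ Rabs (Du i q - c) <= eps) ->
  dist4 a p + Rabs v < r ->
  Rabs (U (ray a v (e4 i)) - U a - c * v) <= eps * Rabs v.
Proof.
  intros Hq Ha.
  assert (Hin : forall s, Rmin 0 v <= s <= Rmax 0 v -> dist4 (ray a s (e4 i)) p < r).
  { intros s Hs. eapply Rle_lt_trans; [apply dist4_tri with (q := a)|].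
    rewrite dist4_ray, norm4_e4, Rmult_1_r.
    assert (Rabs s <= Rabs v); [|lra].
    unfold Rmin, Rmax in Hs. destruct (Rle_dec 0 v).
    - rewrite !Rabs_right; lra.
    - rewrite !Rabs_left1; lra. }
  destruct (MVT_gen (fun s => U (ray a s (e4 i))) 0 v
    (fun s => Du i (ray a s (e4 i)))) as (x & Hx & E).
  - intros s Hs. apply is_derive_Reals, has_partial_ray.
    apply Hpart, Hq, Hin. lra.
  - intros s Hs. apply derivable_continuous_pt. exists (Du i (ray a s (e4 i))).
    apply has_partial_ray, Hpart, Hq, Hin, Hs.
  - rewrite ray0, Rminus_0_r in E. cbn in E.
    replace (_ - _ - _) with ((Du i (ray a x (e4 i)) - c) * v) by lra.
    rewrite Rabs_mult. apply Rmult_le_compat_r; [apply Rabs_pos|]. apply Hq, Hin, Hx.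
Qed.

(** From [p] to [p + v] one moves along one axis at a time; by [partial_step] each of the four moves
    has an error of at most [eps / 4] times its length. *)
Lemma differentiable4 p eps : Om p -> 0 < eps -> exists delta, 0 < delta /\
  forall v, norm4 v < delta ->
    Rabs (U (add4 p v) - U p - dot4 (grad Du p) v) <= eps * norm4 v.
Proof.
  intros Hp He. destruct (Hopen p Hp) as (r0 & Hr0 & H0).
  assert (Hi : forall i, exists r, 0 < r /\ forall q, dist4 q p < r ->
    Om q /\ Rabs (Du i q - Du i p) <= eps / 4).
  { intros i. destruct (Hcont1 i p Hp (eps/4)) as (r & Hr & H); [lra|].
    exists (Rmin r0 r). split; [now apply Rmin_pos|]. intros q Hq. split.
    - apply H0. eapply Rlt_le_trans; [exact Hq|apply Rmin_l].
    - apply Rlt_le, H. eapply Rlt_le_trans; [exact Hq|apply Rmin_r]. }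
  destruct (Hi I1) as (r1 & Hr1 & P1), (Hi I2) as (r2 & Hr2 & P2),
    (Hi I3) as (r3 & Hr3 & P3), (Hi I4) as (r4 & Hr4 & P4).
  (* The path of four axis moves stays within [4 * norm4 v] of [p]. *)
  exists (Rmin (Rmin r1 r2) (Rmin r3 r4) / 4).
  assert (Hm1 := Rmin_l (Rmin r1 r2) (Rmin r3 r4)).
  assert (Hm2 := Rmin_r (Rmin r1 r2) (Rmin r3 r4)).
  assert (Hm3 := Rmin_l r1 r2). assert (Hm4 := Rmin_r r1 r2).
  assert (Hm5 := Rmin_l r3 r4). assert (Hm6 := Rmin_r r3 r4).
  split.
  { assert (0 < Rmin (Rmin r1 r2) (Rmin r3 r4)) by (repeat apply Rmin_pos; easy). lra. }
  intros v Hv.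
  pose proof (coord_le_norm4 I1 v) as C1; pose proof (coord_le_norm4 I2 v) as C2;
  pose proof (coord_le_norm4 I3 v) as C3; pose proof (coord_le_norm4 I4 v) as C4.
  cbn in C1, C2, C3, C4.
  set (a1 := ray p (x1 v) (e4 I1)). set (a2 := ray a1 (x2 v) (e4 I2)).
  set (a3 := ray a2 (x3 v) (e4 I3)).
  assert (E : add4 p v = ray a3 (x4 v) (e4 I4)) by (subst a3 a2 a1; r4eq).
  assert (D1 : dist4 a1 p = Rabs (x1 v)) by (unfold a1; rewrite dist4_ray, norm4_e4; ring).
  assert (D2 : dist4 a2 p <= Rabs (x1 v) + Rabs (x2 v)).
  { eapply Rle_trans; [apply dist4_tri with (q := a1)|].
    unfold a2. rewrite dist4_ray, norm4_e4. lra. }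
  assert (D3 : dist4 a3 p <= Rabs (x1 v) + Rabs (x2 v) + Rabs (x3 v)).
  { eapply Rle_trans; [apply dist4_tri with (q := a2)|].
    unfold a3. rewrite dist4_ray, norm4_e4. lra. }
  assert (S1 := partial_step I1 p r1 _ _ p (x1 v) P1). rewrite dist4_refl in S1.
  assert (S2 := partial_step I2 p r2 _ _ a1 (x2 v) P2).
  assert (S3 := partial_step I3 p r3 _ _ a2 (x3 v) P3).
  assert (S4 := partial_step I4 p r4 _ _ a3 (x4 v) P4).
  fold a1 in S1. fold a2 in S2. fold a3 in S3. rewrite <- E in S4.
  apply Rabs_le_between in S1; [|lra]. apply Rabs_le_between in S2; [|lra].
  apply Rabs_le_between in S3; [|lra]. apply Rabs_le_between in S4; [|lra].
  apply Rabs_le_between. unfold dot4, grad; cbn.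
  assert (forall i, eps / 4 * Rabs (coord i v) <= eps / 4 * norm4 v) as W
    by (intros i; apply Rmult_le_compat_l; [lra|apply coord_le_norm4]).
  pose proof (W I1); pose proof (W I2); pose proof (W I3); pose proof (W I4). cbn in *. lra.
Qed.

Lemma directional_derivative p e :
  Om p -> derivable_pt_lim (fun t => U (ray p t e)) 0 (dot4 (grad Du p) e).
Proof.
  intros Hp eps He. pose proof (norm4_pos e) as Hn.
  destruct (differentiable4 p (eps / (2 * (norm4 e + 1))) Hp) as (d & Hd & H).
  { apply Rdiv_lt_0_compat; lra. }
  assert (Hd' : 0 < d / (norm4 e + 1)) by (apply Rdiv_lt_0_compat; lra).
  exists (mkposreal _ Hd'). intros h Hh Hh'. cbn in Hh'.
  rewrite Rplus_0_l, ray0.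
  assert (Hlt : Rabs h * (norm4 e + 1) < d).
  { apply Rmult_lt_reg_r with (/ (norm4 e + 1)); [apply Rinv_0_lt_compat; lra|].
    rewrite Rmult_assoc, Rinv_r, Rmult_1_r by lra. exact Hh'. }
  pose proof (Rabs_pos_lt h Hh).
  specialize (H (scal4 h e)). rewrite norm4_scal in H.
  assert (Hb := H ltac:(nra)).
  replace (dot4 (grad Du p) (scal4 h e)) with (h * dot4 (grad Du p) e) in Hb
    by (unfold dot4; cbn; ring).
  replace (_ / h - _) with ((U (ray p h e) - U p - h * dot4 (grad Du p) e) / h) by (field; easy).
  unfold Rdiv at 1. rewrite Rabs_mult, Rabs_inv.
  apply Rmult_lt_reg_r with (Rabs h); [easy|].
  rewrite Rmult_assoc, Rinv_l, Rmult_1_r by lra.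
  eapply Rle_lt_trans; [exact Hb|].
  replace (eps / (2 * (norm4 e + 1)) * (Rabs h * norm4 e))
    with ((eps * Rabs h) * (norm4 e / (2 * (norm4 e + 1)))) by (field; lra).
  assert (norm4 e / (2 * (norm4 e + 1)) < 1).
  { apply Rmult_lt_reg_r with (2 * (norm4 e + 1)); [lra|].
    unfold Rdiv. rewrite Rmult_assoc, Rinv_l; lra. }
  assert (0 < eps * Rabs h) by nra. nra.
Qed.

Lemma directional_derivative_ray p e s :
  Om (ray p s e) ->
  derivable_pt_lim (fun t => U (ray p t e)) s (dot4 (grad Du (ray p s e)) e).
Proof.
  intros H eps He. destruct (directional_derivative _ e H eps He) as (d & Hd).
  exists d. intros h Hh Hh'. specialize (Hd h Hh Hh').
  rewrite !ray_ray, Rplus_0_l, Rplus_0_r in Hd. exact Hd.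
Qed.

Lemma C1_continuous p : Om p -> cont4 U p.
Proof.
  intros Hp eps He.
  destruct (differentiable4 p 1 Hp) as (d & Hd & H); [lra|].
  set (G := norm4 (grad Du p)). assert (HG : 0 <= G) by apply norm4_pos.
  exists (Rmin d (eps / (G + 2))). split.
  { apply Rmin_pos; [easy|]. apply Rdiv_lt_0_compat; lra. }
  intros q Hq. pose proof (Rmin_l d (eps / (G + 2))). pose proof (Rmin_r d (eps / (G + 2))).
  specialize (H (sub4 q p) ltac:(unfold dist4 in Hq; lra)).
  replace (add4 p (sub4 q p)) with q in H by r4eq.
  pose proof (cauchy_schwarz4 (grad Du p) (sub4 q p)) as C. fold G in C.
  change (norm4 (sub4 q p)) with (dist4 q p) in *.
  assert (Hm : dist4 q p * (G + 2) < eps).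
  { apply Rlt_le_trans with (eps / (G + 2) * (G + 2)); [|right; field; lra].
    apply Rmult_lt_compat_r; lra. }
  pose proof (dist4_pos q p).
  apply Rabs_le_between in H; apply Rabs_le_between in C. apply Rabs_def1; nra.
Qed.

End ContinuouslyDifferentiable.

(* Leaving [Om] is harmless because [U] vanishes there; the maximum of
   [U (ray p s e) - (c + eta) s] over [0, t] can only sit at [s = 0]. *)
Lemma slope_le Om U Du (HU : roof Om U Du) p e t c :
  0 <= t ->
  (forall s, 0 <= s <= t -> Om (ray p s e) -> dot4 (grad Du (ray p s e)) e <= c) ->
  (forall s, 0 < s <= t -> ~ Om (ray p s e) -> 0 <= c) ->
  U (ray p t e) <= U p + c * t.
Proof.
  intros Ht H1 H2. apply Rnot_lt_le; intros Hlt.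
  assert (Ht0 : 0 < t).
  { destruct Ht as [|<-]; [easy|]. rewrite ray0 in Hlt. lra. }
  set (eta := (U (ray p t e) - U p - c * t) / (2 * t)).
  assert (Heta : 0 < eta) by (apply Rdiv_lt_0_compat; lra).
  assert (Eeta : eta * t = (U (ray p t e) - U p - c * t) / 2)
    by (unfold eta; field; lra).
  set (m := fun s => U (ray p s e) - (c + eta) * s).
  destruct (continuity_ab_maj m 0 t Ht) as (s & Hs & Hs').
  { intros s _. apply (continuity_pt_minus (fun s => U (ray p s e)) (fun s => (c + eta) * s)).
    - apply cont_ray, (roof_cont _ _ _ HU).
    - apply derivable_continuous_pt, derivable_pt_scal, derivable_pt_id. }
  assert (Hm0 : m 0 < m t).
  { unfold m. rewrite ray0. nra. }
  assert (Hmt : m t <= m s) by (apply Hs; lra).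
  assert (Hs0 : 0 < s).
  { destruct (proj1 Hs') as [|<-]; [easy|lra]. }
  destruct (classic (Om (ray p s e))) as [Ho|Ho].
  - destruct (directional_derivative_ray Om U Du (roof_open _ _ _ HU)
      (roof_part _ _ _ HU) (roof_cont1 _ _ _ HU) _ _ _ Ho (eta / 2)) as ([d Hd] & H); [lra|]. cbn in H.
    (* Stepping back by [h], the function [m] would gain at least [eta / 2 * h], because the slope
       at [s] is at most [c]. *)
    set (h := Rmin s (d / 2)).
    assert (Hh : 0 < h) by (apply Rmin_pos; lra).
    assert (h <= s) by apply Rmin_l. assert (h <= d / 2) by apply Rmin_r.
    assert (Hq : Rabs ((U (ray p (s + - h) e) - U (ray p s e)) / - h
       - dot4 (grad Du (ray p s e)) e) < eta / 2)
      by (apply (H (- h)); [lra|rewrite Rabs_Ropp, Rabs_right; lra]).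
    apply Rabs_def2 in Hq.
    assert (Hg := H1 s Hs' Ho).
    assert (Hmax : m (s + - h) <= m s) by (apply Hs; lra).
    unfold m in Hmax.
    set (Q := (U (ray p (s + - h) e) - U (ray p s e)) / - h) in *.
    assert (EQ : U (ray p (s + - h) e) - U (ray p s e) = - (Q * h))
      by (unfold Q; field; lra).
    assert (Q * h <= (c + eta / 2) * h) by (apply Rmult_le_compat_r; lra).
    nra.
  - assert (Hc : 0 <= c) by (apply (H2 s); [lra|easy]).
    assert (m s <= 0).
    { unfold m. rewrite (roof_zero _ _ _ HU _ Ho).
      assert (0 <= (c + eta) * s) by (apply Rmult_le_pos; lra). lra. }
    pose proof (roof_nonneg _ _ _ p HU). unfold m in Hm0. rewrite ray0 in Hm0. fold (m t) in Hm0.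
    unfold m in *. lra.
Qed.

(** * Invariance of the Laplacian under translations and reflections *)

Lemma has2_translate f p a e l : has2 f (add4 p a) e l -> has2 (fun q => f (add4 q a)) p e l.
Proof.
  intros (f' & d & Hd & H1 & H2). exists f', d. split; [easy|]. split; [|easy].
  intros t Ht. apply is_derive_Reals.
  apply is_derive_ext with (fun s => f (ray (add4 p a) s e)).
  - intros s. f_equal. r4eq.
  - now apply is_derive_Reals, H1.
Qed.

Lemma lap_translate f p a l : lap f (add4 p a) l -> lap (fun q => f (add4 q a)) p l.
Proof.
  intros (m & H & <-). exists m. split; [|easy]. intros i. now apply has2_translate.
Qed.

Lemma has2_flip f p e l : has2 f p e l -> has2 f p (scal4 (-1) e) l.
Proof.
  intros (f' & d & Hd & H1 & H2). exists (fun t => - f' (- t)), d. split; [easy|]. split.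
  - intros t Ht. apply is_derive_Reals.
    apply is_derive_ext with (fun s => f (ray p (- s) e)).
    + intros s. f_equal. r4eq.
    + replace (- f' (- t)) with (-1 * f' (- t)) by ring.
      apply (is_derive_comp (fun s => f (ray p s e)) (fun s => - s)).
      * apply is_derive_Reals, H1. now rewrite Rabs_Ropp.
      * auto_derive; [easy|ring].
  - apply is_derive_Reals. replace l with (- (-1 * l)) by ring.
    apply (is_derive_opp (fun t => f' (- t))).
    apply (is_derive_comp f' (fun s => - s)).
    + rewrite Ropp_0. now apply is_derive_Reals.
    + auto_derive; [easy|ring].
Qed.

(** Mirror image in the hyperplane through [a] orthogonal to the [i]-th axis. *)
Definition reflection (i : idx4) (a p : R4) : R4 :=
  ray p (- (2 * (coord i p - coord i a))) (e4 i).

Lemma reflection_ray i j a p : exists e, (e = e4 j \/ e = scal4 (-1) (e4 j)) /\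
  forall s, reflection i a (ray p s (e4 j)) = ray (reflection i a p) s e.
Proof.
  destruct i, j;
  first [ (eexists; split; [left; reflexivity|intros s; r4eq; fail])
        | (eexists; split; [right; reflexivity|intros s; r4eq]) ].
Qed.

Lemma lap_reflection i a f p l : lap f (reflection i a p) l -> lap (fun q => f (reflection i a q)) p l.
Proof.
  intros (m & H & <-). exists m. split; [|easy]. intros j.
  destruct (reflection_ray i j a p) as (e & He & E).
  assert (H' : has2 f (reflection i a p) e (m j)).
  { destruct He as [->| ->]; [apply H|apply has2_flip, H]. }
  destruct H' as (f' & d & Hd & H1 & H2). exists f', d. split; [easy|]. split; [|easy].
  intros t Ht. apply is_derive_Reals.
  apply is_derive_ext with (fun s => f (ray (reflection i a p) s e)).
  - intros s. now rewrite E.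
  - now apply is_derive_Reals, H1.
Qed.

Lemma dist4_reflection i a p q : dist4 (reflection i a p) (reflection i a q) = dist4 p q.
Proof. unfold dist4, norm4. f_equal. unfold dot4. destruct i; cbn; ring. Qed.

Lemma reflection_fixed i a : reflection i a a = a.
Proof. destruct i; r4eq. Qed.

Lemma reflection_on i a p : coord i p = coord i a -> reflection i a p = p.
Proof.
  intros E. unfold reflection. rewrite E.
  replace (- _) with 0 by ring. apply ray0.
Qed.

(** * Laplacians of explicit functions and the gradient estimate *)

(** Compared with [has2], the first derivative at [p] is recorded too: the product and chain rules
    for the Laplacian involve the gradient [G] of [jet]. *)
Definition jet1 (f : R4 -> R) (p e : R4) (a l : R) : Prop :=
  exists f' d, 0 < d /\
    (forall t, Rabs t < d -> derivable_pt_lim (fun s => f (ray p s e)) t (f' t)) /\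
    f' 0 = a /\ derivable_pt_lim f' 0 l.

Definition jet (f : R4 -> R) (p G : R4) (l : R) : Prop :=
  exists m : idx4 -> R, (forall i, jet1 f p (e4 i) (coord i G) (m i)) /\
    m I1 + m I2 + m I3 + m I4 = l.

Lemma jet_lap f p G l : jet f p G l -> lap f p l.
Proof.
  intros (m & H & E). exists m. split; [|easy]. intros i.
  destruct (H i) as (f' & d & Hd & H1 & _ & H2). now exists f', d.
Qed.

Lemma jet_eq f p G l G' l' : jet f p G l -> G = G' -> l = l' -> jet f p G' l'.
Proof. now intros H <- <-. Qed.

Lemma jet_affine v c p : jet (fun q => dot4 v q + c) p v 0.
Proof.
  exists (fun _ => 0). split; [|ring]. intros i.
  exists (fun _ => coord i v), 1. split; [lra|]. split; [|split; [easy|apply derivable_pt_lim_const]].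
  intros t _. apply is_derive_Reals.
  apply is_derive_ext with (fun s => dot4 v p + c + coord i v * s).
  - intros s. destruct i; unfold dot4; cbn; ring.
  - auto_derive; [easy|ring].
Qed.

Lemma jet_ext f g p G l : (forall q, f q = g q) -> jet f p G l -> jet g p G l.
Proof.
  intros E (m & H & Em). exists m. split; [|easy]. intros i.
  destruct (H i) as (f' & d & Hd & H1 & H2). exists f', d. split; [easy|]. split; [|easy].
  intros t Ht. apply is_derive_Reals. apply is_derive_ext with (fun s => f (ray p s (e4 i))).
  - intros; apply E.
  - now apply is_derive_Reals, H1.
Qed.

Lemma jet_plus f g p G H l m :
  jet f p G l -> jet g p H m -> jet (fun q => f q + g q) p (add4 G H) (l + m).
Proof.
  intros (a & Ha & <-) (b & Hb & <-). exists (fun i => a i + b i). split; [|ring].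
  intros i. destruct (Ha i) as (f' & d & Hd & H1 & H2 & H3).
  destruct (Hb i) as (g' & d' & Hd' & H1' & H2' & H3').
  exists (fun t => f' t + g' t), (Rmin d d'). split; [now apply Rmin_pos|]. split; [|split].
  - intros t Ht.
    apply (derivable_pt_lim_plus (fun s => f (ray p s (e4 i))) (fun s => g (ray p s (e4 i)))).
    + apply H1. eapply Rlt_le_trans; [exact Ht|apply Rmin_l].
    + apply H1'. eapply Rlt_le_trans; [exact Ht|apply Rmin_r].
  - rewrite H2, H2'. destruct i; easy.
  - now apply (derivable_pt_lim_plus f' g').
Qed.

Lemma jet_mult f g p G H l m :
  jet f p G l -> jet g p H m ->
  jet (fun q => f q * g q) p (add4 (scal4 (g p) G) (scal4 (f p) H))
    (l * g p + 2 * dot4 G H + f p * m).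
Proof.
  intros (a & Ha & <-) (b & Hb & <-).
  exists (fun i => a i * g p + 2 * (coord i G * coord i H) + f p * b i).
  split; [|unfold dot4; cbn; ring].
  intros i. destruct (Ha i) as (f' & d & Hd & H1 & H2 & H3).
  destruct (Hb i) as (g' & d' & Hd' & H1' & H2' & H3').
  assert (F : derivable_pt_lim (fun s => f (ray p s (e4 i))) 0 (f' 0))
    by (apply H1; rewrite Rabs_R0; lra).
  assert (F' : derivable_pt_lim (fun s => g (ray p s (e4 i))) 0 (g' 0))
    by (apply H1'; rewrite Rabs_R0; lra).
  exists (fun t => f' t * g (ray p t (e4 i)) + f (ray p t (e4 i)) * g' t), (Rmin d d').
  split; [now apply Rmin_pos|]. split; [|split].
  - intros t Ht.
    apply (derivable_pt_lim_mult (fun s => f (ray p s (e4 i))) (fun s => g (ray p s (e4 i)))).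
    + apply H1. eapply Rlt_le_trans; [exact Ht|apply Rmin_l].
    + apply H1'. eapply Rlt_le_trans; [exact Ht|apply Rmin_r].
  - rewrite H2, H2', ray0. destruct i; cbn; ring.
  - assert (X := derivable_pt_lim_plus _ _ _ _ _
      (derivable_pt_lim_mult f' (fun s => g (ray p s (e4 i))) 0 _ _ H3 F')
      (derivable_pt_lim_mult (fun s => f (ray p s (e4 i))) g' 0 _ _ F H3')).
    cbv beta in X. rewrite ray0, H2, H2' in X.
    replace (a i * g p + 2 * (coord i G * coord i H) + f p * b i)
      with (a i * g p + coord i G * coord i H + (coord i G * coord i H + f p * b i)) by ring.
    exact X.
Qed.

Lemma jet_comp (phi phi' : R -> R) phi'' f p G l :
  (exists rho, 0 < rho /\ forall y, Rabs (y - f p) < rho -> derivable_pt_lim phi y (phi' y)) ->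
  derivable_pt_lim phi' (f p) phi'' -> jet f p G l ->
  jet (fun q => phi (f q)) p (scal4 (phi' (f p)) G) (phi'' * dot4 G G + phi' (f p) * l).
Proof.
  intros (rho & Hrho & Hphi) Hphi' (a & Ha & <-).
  exists (fun i => phi'' * (coord i G * coord i G) + phi' (f p) * a i).
  split; [|unfold dot4; cbn; ring].
  intros i. destruct (Ha i) as (f' & d & Hd & H1 & H2 & H3).
  assert (F : derivable_pt_lim (fun s => f (ray p s (e4 i))) 0 (f' 0))
    by (apply H1; rewrite Rabs_R0; lra).
  assert (C : continuity_pt (fun s => f (ray p s (e4 i))) 0)
    by (apply derivable_continuous_pt; now exists (f' 0)).
  destruct (C rho Hrho) as (d' & Hd' & C').
  exists (fun t => phi' (f (ray p t (e4 i))) * f' t), (Rmin d d').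
  split; [now apply Rmin_pos|]. split; [|split].
  - intros t Ht.
    apply (derivable_pt_lim_comp (fun s => f (ray p s (e4 i))) phi).
    + apply H1. eapply Rlt_le_trans; [exact Ht|apply Rmin_l].
    + apply Hphi. destruct (Req_dec t 0) as [->|Hn].
      * rewrite ray0, Rminus_diag, Rabs_R0. lra.
      * specialize (C' t). cbn in C'. unfold Rdist in C'. rewrite ray0 in C'.
        apply C'. split; [split; [easy|congruence]|].
        rewrite Rminus_0_r. eapply Rlt_le_trans; [exact Ht|apply Rmin_r].
  - rewrite H2, ray0. destruct i; easy.
  - assert (X := derivable_pt_lim_mult (fun t => phi' (f (ray p t (e4 i)))) f' 0 _ _
      (derivable_pt_lim_comp (fun s => f (ray p s (e4 i))) phi' 0 _ _ F
        ltac:(cbv beta; rewrite ray0; exact Hphi')) H3).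
    cbv beta in X. rewrite ray0, H2 in X.
    replace (phi'' * (coord i G * coord i G) + phi' (f p) * a i)
      with (phi'' * coord i G * coord i G + phi' (f p) * a i) by ring. exact X.
Qed.

Lemma jet_scal c f p G l : jet f p G l -> jet (fun q => c * f q) p (scal4 c G) (c * l).
Proof.
  intros H. eapply jet_eq.
  - apply (jet_comp (fun x => c * x) (fun _ => c) 0 f p G l); [|apply derivable_pt_lim_const|easy].
    exists 1. split; [lra|]. intros y _. apply is_derive_Reals. auto_derive; [easy|ring].
  - easy.
  - ring.
Qed.

Lemma jet_inv f p G l : f p <> 0 -> jet f p G l ->
  jet (fun q => / f q) p (scal4 (- / f p ^ 2) G) (2 / f p ^ 3 * dot4 G G + - / f p ^ 2 * l).
Proof.
  intros H0 H. apply (jet_comp Rinv (fun y => - / y ^ 2)); [| |easy].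
  - exists (Rabs (f p)). split; [now apply Rabs_pos_lt|]. intros y Hy.
    assert (y <> 0).
    { intros ->. rewrite Rminus_0_l, Rabs_Ropp in Hy. lra. }
    apply is_derive_Reals. auto_derive; [easy|]. field; easy.
  - apply is_derive_Reals. auto_derive; [nra|]. field; easy.
Qed.

Lemma jet_ln f p G l : 0 < f p -> jet f p G l ->
  jet (fun q => ln (f q)) p (scal4 (/ f p) G) (- / f p ^ 2 * dot4 G G + / f p * l).
Proof.
  intros H0 H. apply (jet_comp ln Rinv); [| |easy].
  - exists (f p). split; [easy|]. intros y Hy. apply Rabs_def2 in Hy.
    apply derivable_pt_lim_ln. lra.
  - apply is_derive_Reals. auto_derive; [lra|]. field; lra.
Qed.

Definition sqdist (a p : R4) : R := dot4 (sub4 p a) (sub4 p a).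

Lemma sqdist_dist4 a p : sqdist a p = dist4 p a * dist4 p a.
Proof. unfold sqdist, dist4. now rewrite norm4_sqr. Qed.

Lemma jet_coord i c p : jet (fun q => coord i q - c) p (e4 i) 0.
Proof.
  apply jet_ext with (fun q => dot4 (e4 i) q + - c); [|apply jet_affine].
  intros q. destruct i; unfold dot4; cbn; ring.
Qed.

Lemma jet_sqdist a p : jet (sqdist a) p (scal4 2 (sub4 p a)) 8.
Proof.
  assert (H : forall i, jet (fun q => (coord i q - coord i a) * (coord i q - coord i a)) p
     (scal4 (2 * (coord i p - coord i a)) (e4 i)) 2).
  { intros i. eapply jet_eq; [exact (jet_mult _ _ p _ _ _ _ (jet_coord i _ p) (jet_coord i _ p))| |].
    - destruct i; r4eq.
    - destruct i; unfold dot4; cbn; ring. }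
  eapply jet_eq.
  - apply jet_ext with (2 := jet_plus _ _ _ _ _ _ _
      (jet_plus _ _ _ _ _ _ _ (H I1) (H I2)) (jet_plus _ _ _ _ _ _ _ (H I3) (H I4))).
    intros q. unfold sqdist, dot4; cbn; ring.
  - r4eq.
  - ring.
Qed.

Lemma cont4_sqdist a p : cont4 (sqdist a) p.
Proof.
  apply cont4_ext with (fun q => dist4 q a * dist4 q a).
  - intros; symmetry; apply sqdist_dist4.
  - repeat cont4_step.
Qed.

Lemma derivative_le f l c d :
  0 < d -> f 0 = 0 -> derivable_pt_lim f 0 l ->
  (forall t, 0 < t < d -> f t <= c * t) -> l <= c.
Proof.
  intros Hd H0 Hl H. apply Rnot_lt_le; intros Hlt.
  destruct (Hl (l - c)) as ([a Ha] & H'); [lra|]. cbn in H'.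
  set (t := Rmin (d / 2) (a / 2)).
  assert (Ht : 0 < t) by (apply Rmin_pos; lra).
  assert (Htd : t <= d / 2) by apply Rmin_l.
  assert (Hta : t <= a / 2) by apply Rmin_r.
  specialize (H' t). rewrite Rplus_0_l, H0, Rminus_0_r in H'.
  assert (Hq : Rabs (f t / t - l) < l - c) by (apply H'; [lra|rewrite Rabs_right; lra]).
  apply Rabs_def2 in Hq. specialize (H t ltac:(lra)).
  assert (f t / t <= c).
  { apply Rmult_le_reg_r with t; [easy|]. unfold Rdiv. rewrite Rmult_assoc, Rinv_l; lra. }
  lra.
Qed.

Lemma closed4_ball a d : closed4 (fun p => dist4 p a <= d).
Proof. apply closed4_le. intros; apply cont4_dist. Qed.

(* The right-hand side is strictly superharmonic and dominates the odd part of [U]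
   in the [i]-th variable on the boundary of the half ball. *)
Lemma odd_part_le Om U Du i p0 d M sg :
  roof Om U Du -> 0 < d -> 0 < M -> (forall p, dist4 p p0 <= d -> Om p /\ U p <= M) ->
  sg = 1 \/ sg = -1 -> forall p, dist4 p p0 <= d -> coord i p0 <= coord i p ->
  sg * (U p - U (reflection i p0 p)) <=
    M / d ^ 2 * (sqdist p0 p + 5 * d * (coord i p - coord i p0)
                 - 5 * ((coord i p - coord i p0) * (coord i p - coord i p0))).
Proof.
  intros HU Hd HM Hb Hsg p Hp Hpi.
  assert (HMd : 0 < M / d ^ 2) by (apply Rdiv_lt_0_compat; nra).
  set (X := fun q => coord i q - coord i p0).
  (* The coefficient 5 exceeds 4, which makes the Laplacian [8 - 5 * 2] negative. On the sphere
     [sqdist] equals [d ^ 2] and the other two terms add up to [5 * X * (d - X) >= 0], so the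
     majorant reaches [M]; on the flat part [X = 0] the odd part vanishes. *)
  set (psi := fun q => sqdist p0 q + 5 * d * X q - 5 * (X q * X q)).
  set (w := fun q => sg * (U q - U (reflection i p0 q)) - M / d ^ 2 * psi q).
  assert (HX : forall q, cont4 X q).
  { intros q. unfold X. repeat cont4_step. }
  assert (Hrc : forall q, cont4 (fun q => U (reflection i p0 q)) q).
  { intros q. apply cont4_pre; [intros; rewrite dist4_reflection; lra|].
    apply (roof_cont _ _ _ HU). }
  assert (Hpc : forall q, cont4 psi q).
  { intros q. unfold psi. repeat first [apply HX | apply cont4_sqdist | cont4_step]. }
  assert (Hwc : forall q, cont4 w q).
  { intros q. unfold w.
    repeat first [apply Hrc | apply Hpc | apply (roof_cont _ _ _ HU) | cont4_step]. }
  set (K := fun q => dist4 q p0 <= d /\ 0 <= X q).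
  destruct (max_attained K (d + norm4 p0) w p) as (m & [Hm1 Hm2] & Hmax).
  { apply closed4_and; [apply closed4_ball|now apply closed4_ge]. }
  { intros q [Hq _]. now apply norm4_ball_bound. }
  { split; [easy|]. unfold X. lra. }
  { intros; apply Hwc. }
  assert (Hr : dist4 (reflection i p0 m) p0 <= d).
  { rewrite <- (reflection_fixed i p0) at 2. now rewrite dist4_reflection. }
  cut (w m <= 0).
  { intros Hw. specialize (Hmax p). fold (psi p). unfold w in *.
    enough (sg * (U p - U (reflection i p0 p)) - M / d ^ 2 * psi p <= 0) by (unfold psi, X in *; lra).
    eapply Rle_trans; [apply Hmax|exact Hw]. split; [easy|]. unfold X; lra. }
  apply Rnot_lt_le; intros Hw.
  assert (HXm : X m <= dist4 m p0).
  { unfold X. eapply Rle_trans; [apply Rle_abs|].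
    replace (coord i m - coord i p0) with (coord i (sub4 m p0)) by (destruct i; easy).
    apply coord_le_norm4. }
  pose proof (roof_nonneg _ _ _ m HU) as P1. pose proof (roof_nonneg _ _ _ (reflection i p0 m) HU) as P2.
  destruct (Hb m Hm1) as [Om1 M1]. destruct (Hb _ Hr) as [Om2 M2].
  assert (Hphi : sg * (U m - U (reflection i p0 m)) <= M) by (destruct Hsg as [-> | ->]; lra).
  destruct (Req_dec (X m) 0) as [E0|E0].
  { unfold w in Hw. rewrite reflection_on in Hw by (unfold X in E0; lra).
    unfold psi in Hw. rewrite E0 in Hw.
    assert (0 <= sqdist p0 m) by (unfold sqdist; apply dot4_pos).
    assert (0 <= M / d ^ 2 * sqdist p0 m) by (apply Rmult_le_pos; lra). nra. }
  destruct (Req_dec (dist4 m p0) d) as [Ed|Ed].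
  { unfold w in Hw. assert (d ^ 2 <= psi m).
    { unfold psi. rewrite sqdist_dist4, Ed. nra. }
    assert (M / d ^ 2 * d ^ 2 <= M / d ^ 2 * psi m) by (apply Rmult_le_compat_l; lra).
    replace (M / d ^ 2 * d ^ 2) with M in * by (field; lra). lra. }
  assert (Hlm : local_max w m).
  { destruct (HX m (X m)) as (r & Hr0 & Hr1); [lra|].
    exists (Rmin r (d - dist4 m p0)). split; [apply Rmin_pos; lra|].
    intros q Hq. apply Hmax. split.
    - pose proof (dist4_tri q m p0). pose proof (Rmin_r r (d - dist4 m p0)). lra.
    - pose proof (Rmin_l r (d - dist4 m p0)). specialize (Hr1 q ltac:(lra)).
      apply Rabs_def2 in Hr1. lra. }
  assert (Hpj : lap psi m (-2)).
  { eapply jet_lap, jet_eq.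
    - apply jet_ext with (fun q => sqdist p0 q + (5 * d * X q + (-5) * (X q * X q)));
        [intros; unfold psi; ring|].
      apply jet_plus; [apply jet_sqdist|]. apply jet_plus; [apply jet_scal, jet_coord|].
      apply jet_scal, jet_mult; apply jet_coord.
    - reflexivity.
    - destruct i; unfold dot4; cbn; ring. }
  assert (Hwl : lap w m (sg * (0 - 0) - M / d ^ 2 * -2)).
  { apply lap_minus; [apply lap_scal, lap_minus|now apply lap_scal].
    - now apply (roof_lap _ _ _ HU).
    - now apply lap_reflection, (roof_lap _ _ _ HU). }
  pose proof (lap_local_max _ _ _ Hlm Hwl). lra.
Qed.

(** At [p0] the odd part of [U] has slope [2 * Du i p0] along the axis, and its majorant from
    [odd_part_le] has slope [5 * (M / d)]. *)
Lemma gradient_estimate Om U Du i p0 d M :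
  roof Om U Du -> 0 < d -> 0 < M -> (forall p, dist4 p p0 <= d -> Om p /\ U p <= M) ->
  Rabs (Du i p0) <= 5 / 2 * (M / d).
Proof.
  intros HU Hd HM Hb.
  assert (Hp0 : Om p0) by (apply Hb; rewrite dist4_refl; lra).
  assert (H : forall sg, sg = 1 \/ sg = -1 -> sg * (2 * Du i p0) <= 5 * (M / d)).
  { intros sg Hsg.
    apply (derivative_le (fun t => sg * (U (ray p0 t (e4 i)) - U (ray p0 (- t) (e4 i)))) _ _ d Hd).
    - rewrite Ropp_0. ring.
    - assert (D := roof_part _ _ _ HU i p0 Hp0). unfold has_partial in D.
      apply is_derive_Reals in D. apply is_derive_Reals.
      apply (is_derive_scal (fun t => U (ray p0 t (e4 i)) - U (ray p0 (- t) (e4 i)))).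
      replace (2 * Du i p0) with (Du i p0 - (-1 * Du i p0)) by ring.
      apply (is_derive_minus (fun t => U (ray p0 t (e4 i))) (fun t => U (ray p0 (- t) (e4 i)))).
      + exact D.
      + apply (is_derive_comp (fun t => U (ray p0 t (e4 i))) (fun s => - s)).
        * now rewrite Ropp_0.
        * auto_derive; [easy|ring].
    - intros t Ht.
      assert (E1 : coord i (ray p0 t (e4 i)) - coord i p0 = t) by (destruct i; cbn; ring).
      assert (E2 : reflection i p0 (ray p0 t (e4 i)) = ray p0 (- t) (e4 i))
        by (destruct i; r4eq).
      assert (E3 : sqdist p0 (ray p0 t (e4 i)) = t * t)
        by (destruct i; unfold sqdist, dot4; cbn; ring).
      assert (B := odd_part_le Om U Du i p0 d M sg HU Hd HM Hb Hsg (ray p0 t (e4 i))).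
      rewrite E1, E2, E3 in B.
      eapply Rle_trans; [apply B|].
      + rewrite dist4_ray, norm4_e4, Rabs_right; lra.
      + lra.
      + assert (0 < M / d ^ 2) by (apply Rdiv_lt_0_compat; nra).
        apply Rle_trans with (M / d ^ 2 * (5 * d * t)); [apply Rmult_le_compat_l; nra|].
        right. field. lra. }
  pose proof (H 1 (or_introl eq_refl)). pose proof (H (-1) (or_intror eq_refl)).
  apply Rabs_le_between. lra.
Qed.

Lemma dot4_grad_le Du p e c :
  (forall i, Rabs (Du i p) <= c) -> dot4 (grad Du p) e <= 4 * c * norm4 e.
Proof.
  intros H.
  assert (T : forall i, Du i p * coord i e <= c * norm4 e).
  { intros i. eapply Rle_trans; [apply Rle_abs|]. rewrite Rabs_mult.
    apply Rmult_le_compat; auto using Rabs_pos, coord_le_norm4. }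
  pose proof (T I1); pose proof (T I2); pose proof (T I3); pose proof (T I4).
  unfold dot4, grad; cbn in *. lra.
Qed.

(** * Boundary behaviour *)

Lemma dot4_comm p q : dot4 p q = dot4 q p.
Proof. unfold dot4; ring. Qed.

Lemma dot4_comb a b p q r :
  dot4 (add4 (scal4 a p) (scal4 b q)) r = a * dot4 p r + b * dot4 q r.
Proof. unfold dot4; cbn; ring. Qed.

Lemma dot4_add_l p q r : dot4 (add4 p q) r = dot4 p r + dot4 q r.
Proof. unfold dot4; cbn; ring. Qed.

Lemma dot4_add_r p q r : dot4 r (add4 p q) = dot4 r p + dot4 r q.
Proof. unfold dot4; cbn; ring. Qed.

Lemma dot4_scal_l a p q : dot4 (scal4 a p) q = a * dot4 p q.
Proof. unfold dot4; cbn; ring. Qed.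

Lemma dot4_scal_r a p q : dot4 p (scal4 a q) = a * dot4 p q.
Proof. unfold dot4; cbn; ring. Qed.

Lemma boundary4_notin Om q : open4 Om -> boundary4 Om q -> ~ Om q.
Proof.
  intros Ho Hb Hq. destruct (Ho q Hq) as (r & Hr & H).
  destruct (Hb r Hr) as (_ & p & Hp & Hd). now apply Hp, H.
Qed.

Lemma gradient_near Om Du q L :
  (forall i, lim_within4 Om (Du i) q (coord i L)) -> forall eps, 0 < eps ->
  exists delta, 0 < delta /\ forall p, Om p -> dist4 p q < delta ->
    forall e, dot4 (grad Du p) e <= dot4 L e + eps * norm4 e.
Proof.
  intros H eps He.
  assert (Hi : forall i, exists delta, 0 < delta /\ forall p, Om p -> dist4 p q < delta ->
     Rabs (Du i p - coord i L) <= eps / 4).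
  { intros i. destruct (H i (eps / 4)) as (d & Hd & H1); [lra|].
    exists d. split; [easy|]. intros. now apply Rlt_le, H1. }
  destruct (Hi I1) as (r1 & Hr1 & P1), (Hi I2) as (r2 & Hr2 & P2),
    (Hi I3) as (r3 & Hr3 & P3), (Hi I4) as (r4 & Hr4 & P4).
  exists (Rmin (Rmin r1 r2) (Rmin r3 r4)).
  split; [repeat apply Rmin_pos; easy|]. intros p Hp Hd e.
  assert (Hm1 := Rmin_l (Rmin r1 r2) (Rmin r3 r4)).
  assert (Hm2 := Rmin_r (Rmin r1 r2) (Rmin r3 r4)).
  assert (Hm3 := Rmin_l r1 r2). assert (Hm4 := Rmin_r r1 r2).
  assert (Hm5 := Rmin_l r3 r4). assert (Hm6 := Rmin_r r3 r4).
  assert (X := dot4_grad_le (fun i p => Du i p - coord i L) p e (eps / 4)).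
  replace (dot4 (grad Du p) e)
    with (dot4 L e + dot4 (grad (fun i p => Du i p - coord i L) p) e)
    by (unfold dot4, grad; cbn; ring).
  apply Rplus_le_compat_l. replace (eps * norm4 e) with (4 * (eps / 4) * norm4 e) by field.
  apply X. intros [| | |]; [apply P1|apply P2|apply P3|apply P4]; try easy; lra.
Qed.

Lemma ray_within q e d : 0 < d -> exists t0, 0 < t0 /\
  forall t, 0 <= t < t0 -> dist4 (ray q t e) q < d.
Proof.
  intros Hd. pose proof (norm4_pos e) as Hn.
  exists (d / (norm4 e + 1)). split; [apply Rdiv_lt_0_compat; lra|]. intros t Ht.
  rewrite dist4_ray, Rabs_right by lra.
  assert (t * (norm4 e + 1) < d).
  { apply Rmult_lt_reg_r with (/ (norm4 e + 1)); [apply Rinv_0_lt_compat; lra|].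
    rewrite Rmult_assoc, Rinv_r, Rmult_1_r by lra. apply Ht. }
  nra.
Qed.

Lemma boundary_slope_le Om U Du q L e eps :
  roof Om U Du -> ~ Om q -> (forall i, lim_within4 Om (Du i) q (coord i L)) -> 0 < eps ->
  exists t0, 0 < t0 /\ forall t, 0 <= t < t0 ->
   (forall s, 0 < s <= t -> ~ Om (ray q s e) -> 0 <= dot4 L e + eps) ->
   U (ray q t e) <= (dot4 L e + eps) * t.
Proof.
  intros HU Hq HL He. pose proof (norm4_pos e) as Hn.
  destruct (gradient_near Om Du q L HL (eps / (norm4 e + 1))) as (d & Hd & H).
  { apply Rdiv_lt_0_compat; lra. }
  destruct (ray_within q e d Hd) as (t0 & Ht0 & H0).
  exists t0. split; [easy|]. intros t Ht Hout.
  replace ((dot4 L e + eps) * t) with (U q + (dot4 L e + eps) * t)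
    by (rewrite (roof_zero _ _ _ HU q Hq); ring).
  apply (slope_le Om U Du HU); [lra| |easy].
  intros s Hs Ho. eapply Rle_trans; [apply H; [easy|apply H0; lra]|].
  apply Rplus_le_compat_l.
  apply Rmult_le_reg_r with (norm4 e + 1); [lra|].
  replace (eps / (norm4 e + 1) * norm4 e * (norm4 e + 1)) with (eps * norm4 e) by (field; lra).
  nra.
Qed.

Lemma normal_cone Om q nu m :
  outward_unit_normal Om q nu -> dot4 m nu < 0 ->
  exists t0, 0 < t0 /\ forall t, 0 < t < t0 -> Om (ray q t m).
Proof.
  intros [Hn H] Hm. pose proof (norm4_pos m) as Hp.
  assert (Hp0 : 0 < norm4 m).
  { destruct Hp as [|E]; [easy|]. pose proof (cauchy_schwarz4 m nu) as C.
    rewrite <- E in C. apply Rabs_le_between in C. lra. }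
  (* Half the cosine of the angle between [m] and [- nu], which puts the ray strictly inside the
     cone on which the normal guarantees membership. *)
  set (eps := - dot4 m nu / (2 * norm4 m)).
  assert (Heps : 0 < eps) by (apply Rdiv_lt_0_compat; lra).
  destruct (H eps Heps) as (d & Hd & H1).
  destruct (ray_within q m d Hd) as (t0 & Ht0 & H0).
  exists t0. split; [easy|]. intros t Ht. apply H1; [apply H0; lra|].
  rewrite dist4_ray, Rabs_right by lra.
  replace (dot4 (sub4 (ray q t m) q) nu) with (t * dot4 m nu) by (unfold dot4; cbn; ring).
  replace (- eps * (t * norm4 m)) with (t * dot4 m nu / 2) by (unfold eps; field; lra).
  nra.
Qed.

(* [U] is positive along every ray entering [Om], so [L] has nonnegative product
   with every inward direction; hence [L] is parallel to [nu]. *)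
Lemma boundary_gradient Om U Du q L nu :
  roof Om U Du -> boundary4 Om q -> outward_unit_normal Om q nu ->
  (forall i, lim_within4 Om (Du i) q (coord i L)) -> dot4 L nu = -1 ->
  L = scal4 (-1) nu.
Proof.
  intros HU Hq Hnu HL HLn.
  assert (Hno := boundary4_notin Om q (roof_open _ _ _ HU) Hq).
  assert (Hray : forall m, dot4 m nu < 0 -> 0 <= dot4 L m).
  { intros m Hm. apply Rnot_lt_le; intros Hlt.
    destruct (normal_cone Om q nu m Hnu Hm) as (t0 & Ht0 & H0).
    destruct (boundary_slope_le Om U Du q L m (- dot4 L m / 2) HU Hno HL)
      as (t1 & Ht1 & H1); [lra|].
    set (t := Rmin t0 t1 / 2).
    assert (Hmin : 0 < Rmin t0 t1) by now apply Rmin_pos.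
    pose proof (Rmin_l t0 t1). pose proof (Rmin_r t0 t1).
    assert (Ht : 0 < t) by (unfold t; lra).
    assert (X : U (ray q t m) <= (dot4 L m + - dot4 L m / 2) * t).
    { apply H1; [unfold t; lra|]. intros s Hs Ho. destruct Ho. apply H0. unfold t in Hs. lra. }
    assert (Y := roof_pos _ _ _ HU _ (H0 t ltac:(unfold t; lra))). nra. }
  assert (Hnn : dot4 nu nu = 1).
  { rewrite <- norm4_sqr. destruct Hnu as [-> _]. ring. }
  set (T := add4 L nu).
  assert (HT : dot4 T nu = 0).
  { unfold T. replace (dot4 (add4 L nu) nu) with (dot4 L nu + dot4 nu nu)
      by (unfold dot4; cbn; ring). lra. }
  assert (HLT : dot4 L T = dot4 T T).
  { replace (dot4 T T) with (dot4 L T + dot4 T nu) by (unfold T, dot4; cbn; ring). lra. }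
  assert (HTT : dot4 T T = 0).
  { destruct (dot4_pos T) as [Hpos|E]; [|easy]. exfalso.
    (* Tilting [- nu] against the tangential part [T] of [L] keeps it inward, while [dot4 L m]
       becomes [1 - 2]. *)
    set (m := add4 (scal4 (-1) nu) (scal4 (- (2 / dot4 T T)) T)).
    assert (Hm : dot4 m nu = -1).
    { replace (dot4 m nu) with (- dot4 nu nu + - (2 / dot4 T T) * dot4 T nu)
        by (unfold m; rewrite dot4_comb; ring).
      rewrite Hnn, HT. ring. }
    specialize (Hray m ltac:(lra)).
    replace (dot4 L m) with (- dot4 L nu + - (2 / dot4 T T) * dot4 L T) in Hray
      by (unfold m; rewrite (dot4_comm L (add4 _ _)), dot4_comb, (dot4_comm nu L), (dot4_comm T L); ring).
    rewrite HLn, HLT in Hray.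
    replace (- (2 / dot4 T T) * dot4 T T) with (-2) in Hray by (field; lra). lra. }
  assert (Hz : forall a b c d : R, a * a + b * b + c * c + d * d = 0 ->
     a = 0 /\ b = 0 /\ c = 0 /\ d = 0) by (intros; repeat split; nra).
  destruct (Hz _ _ _ _ HTT) as (Z1 & Z2 & Z3 & Z4). unfold T in *; cbn in *.
  apply R4_eq; cbn; lra.
Qed.

(** The sign is switched here: from now on [n] is the inward unit normal, and it is the boundary
    limit of the gradient itself. *)
Lemma roof_boundary Om U Du q :
  roof Om U Du -> boundary4 Om q -> exists n, norm4 n = 1 /\
    outward_unit_normal Om q (scal4 (-1) n) /\
    forall i, lim_within4 Om (Du i) q (coord i n).
Proof.
  intros HU Hq. destruct (roof_normal _ _ _ HU q Hq) as (nu & Hnu).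
  destruct (roof_bdry _ _ _ HU q Hq) as (L & HL & H).
  rewrite (boundary_gradient Om U Du q L nu HU Hq Hnu HL (H nu Hnu)) in HL.
  exists (scal4 (-1) nu). split; [|split; [|exact HL]].
  - rewrite norm4_scal, (proj1 Hnu). unfold Rabs. destruct (Rcase_abs (-1)); lra.
  - replace (scal4 (-1) (scal4 (-1) nu)) with nu; [easy|]. r4eq.
Qed.

(** For [a] on the sphere of radius [r] about [p0] this is, up to a factor, the Poisson kernel of
    the ball in dimension 4, and it is harmonic. Moving the pole [a] inside the ball makes it
    strictly subharmonic while it still vanishes on the sphere. *)
Lemma lap_kernel p0 a r p :
  sqdist a p <> 0 ->
  lap (fun q => (r ^ 2 - sqdist p0 q) * (/ sqdist a q * / sqdist a q)) p
    (8 * (r ^ 2 - sqdist p0 a) / sqdist a p ^ 3).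
Proof.
  intros H. eapply jet_lap, jet_eq.
  - apply jet_ext with (fun q => (-1 * sqdist p0 q + (dot4 (mkR4 0 0 0 0) q + r ^ 2))
      * (/ sqdist a q * / sqdist a q)).
    { intros q. f_equal. unfold dot4; cbn [x1 x2 x3 x4]. ring. }
    apply jet_mult.
    + apply jet_plus; [apply jet_scal, jet_sqdist|apply jet_affine].
    + apply jet_mult; apply jet_inv; try easy; apply jet_sqdist.
  - reflexivity.
  - assert (E : dot4 (sub4 p p0) (sub4 p a)
      = (sqdist p0 p + sqdist a p - sqdist p0 a) / 2)
      by (unfold sqdist, dot4; cbn; field).
    assert (E' : dot4 (sub4 p a) (sub4 p a) = sqdist a p) by reflexivity.
    assert (E0 : forall v, dot4 (mkR4 0 0 0 0) v = 0) by (intros; unfold dot4; cbn; ring).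
    rewrite !dot4_add_l, !dot4_add_r, !dot4_scal_l, !dot4_scal_r, !E0, E, E'.
    field. exact H.
Qed.

(** * Linear growth *)

(** The factor [5120 ^ 4] comes from the fourth power of the radius [d / 5120] in
    [hopf_lower_bound]. The factor 1024 is [8 * 8 * 16]: an 8 from [weighted_max], an 8 from the
    normalization [kap], and a 16 from the lower bound for the kernel. *)
Definition growth_const : R := 1024 * 5120 ^ 4.

Lemma growth_const_pos : 0 < growth_const.
Proof. unfold growth_const. lra. Qed.

(* The maximum point of [U * (r^2 - |p - p0|^2)^3] replaces Harnack's inequality:
   near it [U] is controlled from above, hence by the gradient estimate from below. *)
Lemma weighted_max Om U Du p0 r :
  roof Om U Du -> 0 < r -> (forall p, dist4 p p0 < r -> Om p) ->
  exists a, dist4 a p0 < r /\ U p0 * r ^ 3 <= 8 * U a * (r - dist4 a p0) ^ 3 /\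
    forall p, dist4 p a <= (r - dist4 a p0) / 2 -> Om p /\ U p <= 64 * U a.
Proof.
  intros HU Hr Hin.
  (* The exponent 3 matches the factor [d ^ 3 / r ^ 3] with which the kernel in [hopf_lower_bound]
     carries the value [U a] to the sphere. *)
  set (Th := fun p => U p * (r ^ 2 - sqdist p0 p) ^ 3).
  destruct (max_attained (fun p => dist4 p p0 <= r) (r + norm4 p0) Th p0) as (a & Ha & Hmax).
  - apply closed4_ball.
  - intros p Hp. now apply norm4_ball_bound.
  - rewrite dist4_refl. lra.
  - intros p _. unfold Th.
    repeat first [apply (roof_cont _ _ _ HU) | apply cont4_sqdist | cont4_step].
  - assert (HU0 : 0 < U p0) by (apply (roof_pos _ _ _ HU), Hin; rewrite dist4_refl; lra).
    assert (H0 : U p0 * (r ^ 2) ^ 3 <= Th a).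
    { specialize (Hmax p0). unfold Th at 1 in Hmax. rewrite sqdist_dist4, dist4_refl in Hmax.
      replace (r ^ 2) with (r ^ 2 - 0 * 0) by ring. apply Hmax. lra. }
    assert (Hr6 : 0 < (r ^ 2) ^ 3) by (repeat apply pow_lt; lra).
    assert (HTha : 0 < Th a) by (eapply Rlt_le_trans; [|exact H0]; nra).
    pose proof (dist4_pos a p0) as Hx0.
    unfold Th in *. rewrite sqdist_dist4 in H0, HTha.
    set (x := dist4 a p0) in *.
    assert (Hxr : x < r).
    { destruct Ha as [|E]; [easy|]. rewrite E in HTha.
      replace (r ^ 2 - r * r) with 0 in HTha by ring.
      rewrite pow_i in HTha by lia. lra. }
    exists a. fold x. split; [easy|].
    assert (HUa : 0 <= U a) by apply (roof_nonneg _ _ _ a HU).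
    assert (Hm : 0 < r ^ 2 - x * x) by nra.
    split.
    + assert (P : (r ^ 2 - x * x) ^ 3 <= (2 * r * (r - x)) ^ 3).
      { apply pow_incr. split; nra. }
      assert (Hr3 : 0 < r ^ 3) by (apply pow_lt; lra).
      apply Rmult_le_reg_r with (r ^ 3); [easy|].
      apply Rle_trans with (U a * (r ^ 2 - x * x) ^ 3).
      * replace (U p0 * r ^ 3 * r ^ 3) with (U p0 * (r ^ 2) ^ 3) by ring. exact H0.
      * replace (8 * U a * (r - x) ^ 3 * r ^ 3) with (U a * (2 * r * (r - x)) ^ 3) by ring.
        now apply Rmult_le_compat_l.
    + intros p Hp.
      assert (Hy : dist4 p p0 <= r - (r - x) / 2).
      { pose proof (dist4_tri p a p0). unfold x in *. lra. }
      pose proof (dist4_pos p p0) as Hy0.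
      split; [apply Hin; lra|].
      assert (Hq := Hmax p ltac:(lra)). rewrite !sqdist_dist4 in Hq. fold x in Hq.
      set (y := dist4 p p0) in *.
      (* Here [r - y >= (r - x) / 2] and [r + y >= (r + x) / 2]. The weight drops at most by
         [4 ^ 3], the source of the 64. *)
      assert (Hc : ((r ^ 2 - x * x) / 4) ^ 3 <= (r ^ 2 - y * y) ^ 3).
      { apply pow_incr. split; [lra|].
        assert ((r - x) / 2 * r <= (r - y) * (r + y)) by (apply Rmult_le_compat; lra). nra. }
      assert (HUp : 0 <= U p) by apply (roof_nonneg _ _ _ p HU).
      apply Rmult_le_reg_r with (((r ^ 2 - x * x) / 4) ^ 3); [apply pow_lt; lra|].
      apply Rle_trans with (U p * (r ^ 2 - y * y) ^ 3); [now apply Rmult_le_compat_l|].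
      eapply Rle_trans; [exact Hq|]. right. field.
Qed.

(** The gradient estimate on balls of radius [d / 4] bounds every slope near [a] by
    [4 * 640 * U a / d]; over a length of [d / 5120] this costs at most half of [U a]. *)
Lemma lower_bound_near_max Om U Du a d :
  roof Om U Du -> 0 < d -> 0 < U a ->
  (forall p, dist4 p a <= d / 2 -> Om p /\ U p <= 64 * U a) ->
  forall p, dist4 p a <= d / 5120 -> U a / 2 <= U p.
Proof.
  intros HU Hd HUa Hb p Hp.
  assert (Hg : forall q, dist4 q a <= d / 4 -> forall i, Rabs (Du i q) <= 640 * U a / d).
  { intros q Hq i. replace (640 * U a / d) with (5 / 2 * ((64 * U a) / (d / 4))) by (field; lra).
    apply (gradient_estimate Om U Du i q (d / 4) (64 * U a) HU); try lra.
    intros z Hz. apply Hb. pose proof (dist4_tri z q a). lra. }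
  set (e := sub4 a p).
  assert (He : norm4 e <= d / 5120).
  { unfold e. change (dist4 a p <= d / 5120). now rewrite dist4_sym. }
  assert (Ea : a = ray p 1 e) by (unfold e; r4eq).
  assert (Hc : 0 <= 640 * U a / d).
  { apply Rlt_le, Rdiv_lt_0_compat; lra. }
  assert (S : U (ray p 1 e) <= U p + (4 * (640 * U a / d) * norm4 e) * 1).
  { apply (slope_le Om U Du HU); [lra| |].
    - intros s Hs _. apply dot4_grad_le. apply Hg.
      rewrite Ea at 1. rewrite dist4_ray2. rewrite Rabs_left1 by lra.
      pose proof (norm4_pos e). nra.
    - intros. pose proof (norm4_pos e). nra. }
  rewrite <- Ea in S.
  assert (4 * (640 * U a / d) * norm4 e <= 4 * (640 * U a / d) * (d / 5120))
    by (apply Rmult_le_compat_l; lra).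
  replace (4 * (640 * U a / d) * (d / 5120)) with (U a / 2) in * by (field; lra). lra.
Qed.

(** The kernel with pole [a] is compared with [U] in the ball with a small ball around [a] removed.
    It vanishes on the outer sphere, and on the inner one [U >= U a / 2] holds. *)
Lemma hopf_lower_bound Om U Du p0 q r :
  roof Om U Du -> 0 < r -> (forall p, dist4 p p0 < r -> Om p) -> dist4 q p0 = r ->
  exists t0, 0 < t0 /\ forall t, 0 < t < t0 ->
    U p0 * t <= growth_const * U (ray q t (sub4 p0 q)).
Proof.
  intros HU Hr Hin Hq.
  destruct (weighted_max Om U Du p0 r HU Hr Hin) as (a & Ha & HUa & Hb).
  assert (HUa0 : 0 < U a) by (apply (roof_pos _ _ _ HU), Hin, Ha).
  set (d := r - dist4 a p0) in *.
  assert (Hd : 0 < d) by (unfold d; lra).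
  assert (Hlow := lower_bound_near_max Om U Du a d HU Hd HUa0 Hb).
  set (rho := d / 5120) in *.
  assert (Hrho : 0 < rho) by (unfold rho; lra).
  set (w := fun p => (r ^ 2 - sqdist p0 p) * (/ sqdist a p * / sqdist a p)).
  (* Normalized so that [kap * w <= U a / 2] on the inner sphere, where
     [r ^ 2 - sqdist p0 <= 4 * r * d]. *)
  set (kap := U a * rho ^ 4 / (8 * r * d)).
  assert (Hkap : 0 < kap).
  { apply Rdiv_lt_0_compat; [apply Rmult_lt_0_compat; [easy|now apply pow_lt]|nra]. }
  set (K := fun p => dist4 p p0 <= r /\ rho <= dist4 p a).
  assert (HKa : forall p, rho <= dist4 p a -> 0 < sqdist a p).
  { intros p Hp. rewrite sqdist_dist4. nra. }
  assert (Hle : forall p, K p -> kap * w p <= U p).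
  { intros p Hp. set (v := fun p => kap * w p - U p).
    destruct (max_attained K (r + norm4 p0) v p) as (m & [Hm1 Hm2] & Hmax); [| |easy| |].
    - apply closed4_and; [apply closed4_ball|apply closed4_ge; intros; apply cont4_dist].
    - intros z [Hz _]. now apply norm4_ball_bound.
    - intros z [_ Hz]. specialize (HKa z Hz). unfold v, w.
      repeat first [apply (roof_cont _ _ _ HU) | apply cont4_sqdist | cont4_step | apply Rgt_not_eq; exact HKa].
    - cut (v m <= 0). { intros Hv. specialize (Hmax p Hp). unfold v in *. lra. }
      apply Rnot_lt_le; intros Hv.
      assert (HSm := HKa m Hm2).
      assert (HUm := roof_nonneg _ _ _ m HU).
      destruct (Req_dec (dist4 m p0) r) as [E1|E1].
      { unfold v, w in Hv. rewrite (sqdist_dist4 p0), E1 in Hv.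
        replace (r ^ 2 - r * r) with 0 in Hv by ring. lra. }
      destruct (Req_dec (dist4 m a) rho) as [E2|E2].
      { assert (HL := Hlow m ltac:(lra)).
        assert (Ew : kap * w m <= U a / 2); [|unfold v in Hv; lra].
        assert (HN : r ^ 2 - sqdist p0 m <= 4 * r * d).
        { rewrite sqdist_dist4. pose proof (dist4_tri a m p0) as T.
          rewrite (dist4_sym a m), E2 in T.
          assert (Ed : d = r - dist4 a p0) by reflexivity.
          assert (Er : rho = d / 5120) by reflexivity.
          assert (r - dist4 m p0 <= 2 * d) by lra.
          pose proof (dist4_pos m p0). nra. }
        unfold w. rewrite (sqdist_dist4 a), E2.
        replace (kap * ((r ^ 2 - sqdist p0 m) * (/ (rho * rho) * / (rho * rho))))
          with (U a / (8 * r * d) * (r ^ 2 - sqdist p0 m))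
          by (unfold kap; field; repeat split; lra).
        apply Rle_trans with (U a / (8 * r * d) * (4 * r * d)).
        - apply Rmult_le_compat_l; [|easy]. apply Rlt_le, Rdiv_lt_0_compat; nra.
        - right. field. split; lra. }
      assert (Hlm : local_max v m).
      { exists (Rmin (r - dist4 m p0) (dist4 m a - rho)).
        split; [apply Rmin_pos; lra|]. intros z Hz. apply Hmax.
        pose proof (Rmin_l (r - dist4 m p0) (dist4 m a - rho)).
        pose proof (Rmin_r (r - dist4 m p0) (dist4 m a - rho)).
        split.
        - pose proof (dist4_tri z m p0). lra.
        - pose proof (dist4_tri m z a). rewrite (dist4_sym m z) in *. lra. }
      assert (Hvl : lap v m (kap * (8 * (r ^ 2 - sqdist p0 a) / sqdist a m ^ 3) - 0)).
      { apply lap_minus.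
        - apply lap_scal, lap_kernel. lra.
        - apply (roof_lap _ _ _ HU), Hin. lra. }
      assert (Hn := lap_local_max _ _ _ Hlm Hvl).
      assert (0 < kap * (8 * (r ^ 2 - sqdist p0 a) / sqdist a m ^ 3)); [|lra].
      apply Rmult_lt_0_compat; [easy|]. apply Rdiv_lt_0_compat; [|now apply pow_lt].
      rewrite sqdist_dist4. pose proof (dist4_pos a p0). nra. }
  exists (Rmin 1 ((d - rho) / r)).
  assert (Hdr : rho < d) by (unfold rho; lra).
  split. { apply Rmin_pos; [lra|]. apply Rdiv_lt_0_compat; lra. }
  intros t [Ht0 Ht]. pose proof (Rmin_l 1 ((d - rho) / r)). pose proof (Rmin_r 1 ((d - rho) / r)).
  assert (Htr : t * r < d - rho).
  { apply Rmult_lt_reg_r with (/ r); [now apply Rinv_0_lt_compat|].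
    rewrite Rmult_assoc, Rinv_r, Rmult_1_r by lra. unfold Rdiv in *. lra. }
  set (p := ray q t (sub4 p0 q)).
  assert (Dp : dist4 p p0 = (1 - t) * r).
  { unfold dist4. replace (sub4 p p0) with (scal4 (1 - t) (sub4 q p0)) by (unfold p; r4eq).
    rewrite norm4_scal, Rabs_right by lra. unfold dist4 in Hq. now rewrite Hq. }
  assert (Da : rho <= dist4 p a).
  { pose proof (dist4_tri p a p0). unfold d in *. lra. }
  assert (Da2 : dist4 p a <= 2 * r).
  { pose proof (dist4_tri p p0 a). rewrite (dist4_sym p0 a) in *. unfold d in *. nra. }
  assert (HUp := Hle p ltac:(split; [nra|easy])).
  (* The numerator is [r ^ 2 * (2 * t - t ^ 2) >= r ^ 2 * t], and the distance to the pole is at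
     most [2 * r]. *)
  assert (Hw : t / (16 * r ^ 2) <= w p).
  { unfold w. rewrite (sqdist_dist4 p0), Dp, sqdist_dist4.
    assert (Hs : dist4 p a * dist4 p a <= 4 * r ^ 2) by nra.
    assert (Hi : / (4 * r ^ 2) <= / (dist4 p a * dist4 p a))
      by (apply Rinv_le_contravar; nra).
    assert (Hi0 : 0 < / (4 * r ^ 2)) by (apply Rinv_0_lt_compat; nra).
    replace (t / (16 * r ^ 2)) with ((r ^ 2 * t) * (/ (4 * r ^ 2) * / (4 * r ^ 2)))
      by (field; lra).
    apply Rmult_le_compat; try nra. }
  unfold growth_const.
  assert (Hk : kap * (t / (16 * r ^ 2)) <= U p)
    by (eapply Rle_trans; [apply Rmult_le_compat_l|exact HUp]; lra).
  replace (kap * (t / (16 * r ^ 2))) with (U a * d ^ 3 * t / (128 * 5120 ^ 4 * r ^ 3)) in Hk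
    by (unfold kap, rho; field; lra).
  assert (Hr3 : 0 < r ^ 3) by now apply pow_lt.
  apply Rmult_le_reg_r with (r ^ 3); [easy|].
  apply Rle_trans with (8 * U a * d ^ 3 * t); [nra|].
  replace (8 * U a * d ^ 3 * t)
    with (1024 * 5120 ^ 4 * (U a * d ^ 3 * t / (128 * 5120 ^ 4 * r ^ 3)) * r ^ 3)
    by (field; lra).
  apply Rmult_le_compat_r; [lra|]. apply Rmult_le_compat_l; [lra|]. exact Hk.
Qed.

Lemma closed4_complement Om : open4 Om -> closed4 (fun p => ~ Om p).
Proof.
  intros H p Hp. destruct (H p (NNPP _ Hp)) as (r & Hr & H1).
  exists r. split; [easy|]. intros q Hq Hn. now apply Hn, H1.
Qed.

Lemma nearest_complement Om p z :
  open4 Om -> Om p -> ~ Om z -> exists q, ~ Om q /\ 0 < dist4 q p /\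
    dist4 q p <= dist4 z p /\ forall x, dist4 x p < dist4 q p -> Om x.
Proof.
  intros Ho Hp Hz.
  destruct (max_attained (fun q => ~ Om q /\ dist4 q p <= dist4 z p)
    (dist4 z p + norm4 p) (fun q => - dist4 q p) z) as (q & [Hq1 Hq2] & Hmax).
  - apply closed4_and; [now apply closed4_complement|apply closed4_ball].
  - intros q [_ Hq]. now apply norm4_ball_bound.
  - split; [easy|lra].
  - intros q _. repeat cont4_step.
  - exists q. repeat split; try easy.
    + destruct (Ho p Hp) as (d & Hd & H).
      apply Rnot_le_lt; intros Hle. apply Hq1, H. lra.
    + intros x Hx. apply NNPP; intros Hn. specialize (Hmax x ltac:(split; [easy|lra])). lra.
Qed.

(** On the segment from the nearest complement point [q] towards [p] there are two bounds linear in
    [t]: Hopf's from below, with factor [U p], and one from above by the unit boundary gradient,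
    with factor about [r]. Comparing them at one small [t] leaves an error [eps]. *)
Lemma linear_growth Om U Du p z :
  roof Om U Du -> Om p -> ~ Om z -> U p <= growth_const * dist4 p z.
Proof.
  intros HU Hp Hz.
  destruct (nearest_complement Om p z (roof_open _ _ _ HU) Hp Hz)
    as (q & Hq1 & Hr & Hq2 & Hin).
  set (r := dist4 q p) in *. rewrite (dist4_sym p z).
  assert (Hb : boundary4 Om q).
  { intros d Hd. split.
    - destruct (ray_within q (sub4 p q) d Hd) as (t0 & Ht0 & H0).
      set (t := Rmin t0 1 / 2).
      assert (Hmin : 0 < Rmin t0 1) by (apply Rmin_pos; lra).
      pose proof (Rmin_l t0 1). pose proof (Rmin_r t0 1).
      exists (ray q t (sub4 p q)). split; [|apply H0; unfold t; lra].
      apply Hin. unfold dist4.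
      replace (sub4 (ray q t (sub4 p q)) p) with (scal4 (1 - t) (sub4 q p)) by r4eq.
      rewrite norm4_scal, Rabs_right by (unfold t; lra).
      change (norm4 (sub4 q p)) with r. unfold t. nra.
    - exists q. split; [easy|]. now rewrite dist4_refl. }
  destruct (roof_boundary Om U Du q HU Hb) as (n & Hn & _ & Hlim).
  destruct (hopf_lower_bound Om U Du p q r HU Hr Hin eq_refl) as (t0 & Ht0 & H0).
  apply Rle_trans with (growth_const * r);
    [|apply Rmult_le_compat_l; [apply Rlt_le, growth_const_pos|easy]].
  pose proof growth_const_pos as HC.
  apply le_epsilon. intros eps He.
  destruct (boundary_slope_le Om U Du q n (sub4 p q) (eps / growth_const) HU Hq1 Hlim)
    as (t1 & Ht1 & H1); [now apply Rdiv_lt_0_compat|].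
  set (t := Rmin (Rmin t0 t1) 1 / 2).
  assert (Hmin : 0 < Rmin (Rmin t0 t1) 1) by (repeat apply Rmin_pos; lra).
  pose proof (Rmin_l (Rmin t0 t1) 1). pose proof (Rmin_r (Rmin t0 t1) 1).
  pose proof (Rmin_l t0 t1). pose proof (Rmin_r t0 t1).
  assert (Ht : 0 < t) by (unfold t; lra).
  specialize (H0 t ltac:(unfold t in *; lra)).
  assert (Hup : U (ray q t (sub4 p q)) <= (dot4 n (sub4 p q) + eps / growth_const) * t).
  { apply H1; [unfold t in *; lra|]. intros s Hs Ho. destruct Ho. apply Hin. unfold dist4.
    replace (sub4 (ray q s (sub4 p q)) p) with (scal4 (1 - s) (sub4 q p)) by r4eq.
    rewrite norm4_scal, Rabs_right by (unfold t in *; lra).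
    change (norm4 (sub4 q p)) with r. nra. }
  assert (Hcs : dot4 n (sub4 p q) <= r).
  { eapply Rle_trans; [apply Rle_abs|]. eapply Rle_trans; [apply cauchy_schwarz4|].
    rewrite Hn. change (1 * dist4 p q <= r). rewrite dist4_sym. fold r. lra. }
  apply Rmult_le_reg_r with t; [easy|].
  eapply Rle_trans; [exact H0|].
  apply Rle_trans with (growth_const * ((r + eps / growth_const) * t)).
  + apply Rmult_le_compat_l; [lra|]. eapply Rle_trans; [exact Hup|].
    apply Rmult_le_compat_r; lra.
  + right. field. lra.
Qed.

(** * The gradient bound *)

(** On the ball of half the distance to the complement, [U] is at most a multiple of the radius,
    which cancels in the gradient estimate and leaves [15 / 2 * growth_const]. *)
Lemma gradient_bounded Om U Du p z i :
  roof Om U Du -> Om p -> ~ Om z -> Rabs (Du i p) <= 8 * growth_const.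
Proof.
  intros HU Hp Hz. pose proof growth_const_pos as HC.
  destruct (nearest_complement Om p z (roof_open _ _ _ HU) Hp Hz)
    as (q & Hq1 & Hr & _ & Hin).
  set (r := dist4 q p) in *.
  apply Rle_trans with (5 / 2 * ((growth_const * (3 / 2 * r)) / (r / 2))).
  - apply (gradient_estimate Om U Du i p (r / 2) _ HU); [lra|nra|].
    intros x Hx. assert (Hox : Om x) by (apply Hin; lra). split; [easy|].
    eapply Rle_trans; [exact (linear_growth Om U Du x q HU Hox Hq1)|].
    apply Rmult_le_compat_l; [lra|]. pose proof (dist4_tri x p q).
    rewrite (dist4_sym p q) in *. fold r in H. lra.
  - replace (5 / 2 * (growth_const * (3 / 2 * r) / (r / 2))) with (15 / 2 * growth_const)
      by (field; lra). lra.
Qed.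

Lemma uniform_small (P : R4 -> R -> Prop) (Rad : R) :
  (forall c, exists d, 0 < d /\ forall p t, dist4 p c < d -> 0 < t < d -> P p t) ->
  exists d, 0 < d /\ forall p t, norm4 p <= Rad -> 0 < t < d -> P p t.
Proof.
  intros H.
  set (D := fun c => proj1_sig (constructive_indefinite_description _ (H c))).
  assert (HD : forall c, 0 < D c /\ forall p t, dist4 p c < D c -> 0 < t < D c -> P p t).
  { intros c. unfold D. now destruct (constructive_indefinite_description _ (H c)). }
  destruct (compact_cover Rad D (fun c => proj1 (HD c))) as (l & Hl).
  destruct (classic (l = nil)) as [->|Hn].
  - exists 1. split; [lra|]. intros p t Hp _. now destruct (Hl p Hp) as (c & [] & _).
  - destruct (list_argmax _ (fun c => - D c) l Hn) as (a & _ & Ha).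
    exists (D a). split; [apply HD|]. intros p t Hp Ht.
    destruct (Hl p Hp) as (c & Hc & Hd). specialize (Ha c Hc).
    apply (proj2 (HD c)); [easy|lra].
Qed.

Lemma ln_unbounded M : exists s0, forall s, s0 < s -> M < ln s.
Proof.
  exists (exp M). intros s Hs. rewrite <- (ln_exp M). apply ln_increasing; [apply exp_pos|easy].
Qed.

(** The first logarithm provides the growth, but its Laplacian has the positive leading term
    [2 / (1 + dot4 p p)]. The parenthesis after it is bounded and cancels exactly this term. What
    remains is of order [1 / (1 + x1 p ^ 2)], which the second logarithm beats for [x1 p ^ 2 >= 4].
    The term with [K] is superharmonic and takes care of the bounded part of the domain with
    [x1 p ^ 2 < 4]. *)
Definition barrier (K : R) (p : R4) : R :=
  / 2 * ln (1 + dot4 p p) + (1 - x1 p ^ 2 * / (1 + dot4 p p))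
  + (14 * ln (1 + x1 p ^ 2) + K * / (1 + dot4 p p)).

Lemma x1_sqr_le p : x1 p ^ 2 <= dot4 p p.
Proof. unfold dot4. nra. Qed.

Lemma barrier_ge K p : 0 <= K -> / 2 * ln (1 + dot4 p p) <= barrier K p.
Proof.
  intros HK. unfold barrier.
  pose proof (x1_sqr_le p) as H1. pose proof (dot4_pos p) as H2.
  assert (x1 p ^ 2 * / (1 + dot4 p p) <= 1).
  { apply Rmult_le_reg_r with (1 + dot4 p p); [lra|]. rewrite Rmult_assoc, Rinv_l; lra. }
  assert (0 <= ln (1 + x1 p ^ 2)).
  { rewrite <- ln_1. apply ln_le; [lra|]. pose proof (pow2_ge_0 (x1 p)). lra. }
  assert (0 <= K * / (1 + dot4 p p)).
  { apply Rmult_le_pos; [easy|]. apply Rlt_le, Rinv_0_lt_compat. lra. }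
  lra.
Qed.

Lemma barrier_nonneg K p : 0 <= K -> 0 <= barrier K p.
Proof.
  intros HK. eapply Rle_trans; [|now apply barrier_ge].
  apply Rmult_le_pos; [lra|]. rewrite <- ln_1. apply ln_le; [lra|].
  pose proof (dot4_pos p). lra.
Qed.

Lemma cont4_ln f p : 0 < f p -> cont4 f p -> cont4 (fun q => ln (f q)) p.
Proof.
  intros H Hf. apply (cont4_comp ln); [|easy].
  apply derivable_continuous_pt. exists (/ f p). now apply derivable_pt_lim_ln.
Qed.

Lemma cont4_dot4 p : cont4 (fun q => dot4 q q) p.
Proof. unfold dot4. repeat cont4_step. Qed.

Lemma cont4_barrier K p : cont4 (barrier K) p.
Proof.
  pose proof (dot4_pos p). pose proof (pow2_ge_0 (x1 p)). unfold barrier.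
  repeat first [apply cont4_ln | apply cont4_dot4 | cont4_step | lra | apply Rgt_not_eq; lra].
Qed.

Lemma lap_barrier K p :
  lap (barrier K) p
   (2 / (1 + dot4 p p) ^ 2 + 8 * x1 p ^ 2 / (1 + dot4 p p) ^ 2
    + 8 * x1 p ^ 2 / (1 + dot4 p p) ^ 3
    + 28 * (1 - x1 p ^ 2) / (1 + x1 p ^ 2) ^ 2 - 8 * K / (1 + dot4 p p) ^ 3).
Proof.
  pose proof (dot4_pos p) as H1. pose proof (pow2_ge_0 (x1 p)) as H2.
  assert (JS : jet (fun q => 1 + dot4 q q) p (scal4 2 p) 8).
  { eapply jet_eq.
    - apply jet_ext with (fun q => (dot4 (mkR4 0 0 0 0) q + 1) + sqdist (mkR4 0 0 0 0) q).
      + intros q. unfold sqdist, dot4; cbn; ring.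
      + apply jet_plus; [apply jet_affine|apply jet_sqdist].
    - r4eq.
    - ring. }
  assert (JX : jet (fun q => x1 q ^ 2) p (scal4 (2 * x1 p) (e4 I1)) 2).
  { eapply jet_eq.
    - apply jet_ext with (fun q => (dot4 (e4 I1) q + 0) * (dot4 (e4 I1) q + 0)).
      + intros q. unfold dot4; cbn; ring.
      + apply jet_mult; apply jet_affine.
    - unfold dot4; r4eq.
    - unfold dot4; cbn; ring. }
  assert (J1 : forall c, jet (fun _ => c) p (mkR4 0 0 0 0) 0).
  { intros c. apply jet_ext with (fun q => dot4 (mkR4 0 0 0 0) q + c); [|apply jet_affine].
    intros q. unfold dot4; cbn; ring. }
  assert (JX1 : jet (fun q => 1 + x1 q ^ 2) p (scal4 (2 * x1 p) (e4 I1)) 2).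
  { eapply jet_eq; [apply jet_plus; [apply J1|apply JX]|r4eq|ring]. }
  assert (JI : jet (fun q => / (1 + dot4 q q)) p _ _) by (apply jet_inv; [lra|exact JS]).
  assert (JL : jet (fun q => ln (1 + dot4 q q)) p _ _) by (apply jet_ln; [lra|exact JS]).
  assert (JLX : jet (fun q => ln (1 + x1 q ^ 2)) p _ _) by (apply jet_ln; [lra|exact JX1]).
  eapply jet_lap, jet_eq.
  - apply jet_ext with (fun q => (/ 2 * ln (1 + dot4 q q)
      + (1 + -1 * (x1 q ^ 2 * / (1 + dot4 q q))))
      + (14 * ln (1 + x1 q ^ 2) + K * / (1 + dot4 q q))).
    { intros q. unfold barrier. ring. }
    apply jet_plus; apply jet_plus.
    + apply jet_scal, JL.
    + apply jet_plus; [apply J1|]. apply jet_scal, jet_mult; [apply JX|apply JI].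
    + apply jet_scal, JLX.
    + apply jet_scal, JI.
  - reflexivity.
  - assert (E1 : dot4 (e4 I1) (e4 I1) = 1) by (unfold dot4; cbn; ring).
    assert (E2 : dot4 (e4 I1) p = x1 p) by (unfold dot4; cbn; ring).
    rewrite !dot4_scal_l, !dot4_scal_r, E1, E2.
    field. lra.
Qed.

Lemma barrier_superharmonic K S p :
  0 <= K -> 6 * (1 + S) ^ 3 <= K -> (x1 p ^ 2 < 4 -> dot4 p p <= S) ->
  exists l, l < 0 /\ lap (barrier K) p l.
Proof.
  intros HK' HK HS. eexists. split; [|apply lap_barrier].
  pose proof (dot4_pos p) as H1. pose proof (pow2_ge_0 (x1 p)) as H2.
  pose proof (x1_sqr_le p) as H3.
  set (X := x1 p ^ 2) in *. set (s := dot4 p p) in *.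
  assert (I3 : / (1 + s) ^ 3 <= / (1 + s) ^ 2).
  { apply Rinv_le_contravar; [apply pow_lt; lra|].
    apply Rle_pow; [lra|]. repeat constructor. }
  assert (I30 : 0 < / (1 + s) ^ 3) by (apply Rinv_0_lt_compat, pow_lt; lra).
  assert (I20 : 0 < / (1 + s) ^ 2) by (apply Rinv_0_lt_compat, pow_lt; lra).
  unfold Rdiv.
  destruct (Rlt_le_dec X 4) as [HX|HX].
  (* In the slab the other terms add up to at most [2 + 8 + 8 + 28 = 46], and the choice of [K]
     subtracts at least 48. *)
  - specialize (HS HX).
    assert (HS3 : (1 + s) ^ 3 <= (1 + S) ^ 3) by (apply pow_incr; lra).
    assert (B0 : (1 + s) ^ 3 * / (1 + s) ^ 3 = 1) by (apply Rinv_r, pow_nonzero; lra).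
    assert (B1 : (1 + s) ^ 2 * / (1 + s) ^ 2 = 1) by (apply Rinv_r, pow_nonzero; lra).
    assert (B2 : 48 <= 8 * K * / (1 + s) ^ 3) by nra.
    assert (B3 : / (1 + s) ^ 2 <= 1) by nra.
    assert (B4 : X * / (1 + s) ^ 2 <= 1).
    { apply Rle_trans with ((1 + s) ^ 2 * / (1 + s) ^ 2); [|lra].
      apply Rmult_le_compat_r; [lra|]. nra. }
    assert (B5 : X * / (1 + s) ^ 3 <= 1) by nra.
    assert (B6 : (1 - X) * / (1 + X) ^ 2 <= 1).
    { apply Rmult_le_reg_r with ((1 + X) ^ 2); [apply pow_lt; lra|].
      rewrite Rmult_assoc, Rinv_l by (apply pow_nonzero; lra). nra. }
    lra.
  (* Off the slab the first three terms are at most [(2 + 16 * X) * c] and the second logarithm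
     gives [28 * (1 - X) * c]; the sum [(30 - 12 * X) * c] is negative since [X >= 4]. *)
  - assert (IX : / (1 + s) ^ 2 <= / (1 + X) ^ 2).
    { apply Rinv_le_contravar; [apply pow_lt; lra|]. apply pow_incr; lra. }
    assert (IX0 : 0 < / (1 + X) ^ 2) by (apply Rinv_0_lt_compat, pow_lt; lra).
    assert (HK0 : 0 <= K * / (1 + s) ^ 3) by (apply Rmult_le_pos; lra).
    set (a := / (1 + s) ^ 2) in *. set (b := / (1 + s) ^ 3) in *. set (c := / (1 + X) ^ 2) in *.
    assert (X * a <= X * c) by nra. assert (X * b <= X * c) by nra.
    assert (30 * c < 12 * (X * c)) by nra.
    lra.
Qed.

(** Supplies the boundary values for the comparison of difference quotients. On a short segment near
    a boundary point [U] grows only inside [Om], where its gradient is close to a unit vector. The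
    form in [c] and [d] is the one [uniform_small] makes uniform on balls. *)
Lemma difference_small Om U Du e eta c :
  roof Om U Du -> norm4 e = 1 -> 0 < eta ->
  exists d, 0 < d /\ forall p t, dist4 p c < d -> 0 < t < d ->
    ~ Om p -> U (ray p t e) <= (1 + eta) * t.
Proof.
  intros HU He Heta. destruct (classic (Om c)) as [Hc|Hc].
  { destruct (roof_open _ _ _ HU c Hc) as (d & Hd & H). exists d. split; [easy|].
    intros p t Hp _ Hn. destruct Hn. now apply H. }
  destruct (classic (boundary4 Om c)) as [Hb|Hb].
  - destruct (roof_boundary Om U Du c HU Hb) as (n & Hn & _ & Hlim).
    destruct (gradient_near Om Du c n Hlim eta Heta) as (d & Hd & H).
    exists (d / 2). split; [lra|]. intros p t Hp Ht Ho.
    replace ((1 + eta) * t) with (U p + (1 + eta) * t)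
      by (rewrite (roof_zero _ _ _ HU p Ho); ring).
    apply (slope_le Om U Du HU); [lra| |intros; lra].
    intros s Hs Hos. eapply Rle_trans; [apply H; [easy|]|].
    + eapply Rle_lt_trans; [apply dist4_tri with (q := p)|].
      rewrite dist4_ray, He, Rabs_right by lra. lra.
    + assert (dot4 n e <= 1); [|rewrite He; lra].
      eapply Rle_trans; [apply Rle_abs|]. eapply Rle_trans; [apply cauchy_schwarz4|].
      rewrite Hn, He. lra.
  - assert (Hext : exists d, 0 < d /\ forall q, Om q -> ~ dist4 q c < d).
    { apply NNPP; intros Hno. apply Hb. intros d Hd. split.
      - apply NNPP; intros Hq. apply Hno. exists d. split; [easy|]. intros q Hq1 Hq2.
        apply Hq. now exists q.
      - exists c. now rewrite dist4_refl. }
    destruct Hext as (d & Hd & H). exists (d / 2). split; [lra|]. intros p t Hp Ht _.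
    rewrite (roof_zero _ _ _ HU); [nra|]. intros Ho. apply (H _ Ho).
    eapply Rle_lt_trans; [apply dist4_tri with (q := p)|].
    rewrite dist4_ray, He, Rabs_right by lra. lra.
Qed.

(* Phragmen-Lindelof for the difference quotients of [U], which unlike the
   partial derivatives are known to be twice differentiable. *)
Lemma gradient_le_1 Om U Du S z e p0 :
  roof Om U Du -> (forall p, Om p -> x1 p ^ 2 < 4 -> dot4 p p <= S) -> ~ Om z ->
  norm4 e = 1 -> Om p0 -> dot4 (grad Du p0) e <= 1.
Proof.
  intros HU HS Hz He Hp0. apply Rnot_lt_le; intros Hlt.
  (* The excess over one is split in three: for replacing the derivative by a quotient, for the
     barrier at [p0], and as margin in [difference_small]. *)
  set (eta := (dot4 (grad Du p0) e - 1) / 3).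
  assert (Heta : 0 < eta) by (unfold eta; lra).
  set (K := Rmax 0 (6 * (1 + S) ^ 3)).
  assert (HK0 : 0 <= K) by apply Rmax_l.
  assert (HK : 6 * (1 + S) ^ 3 <= K) by apply Rmax_r.
  set (C := 4 * (8 * growth_const)).
  assert (HC : 0 < C) by (pose proof growth_const_pos; unfold C; lra).
  assert (Hlip : forall p t, 0 <= t -> U (ray p t e) <= U p + C * t).
  { intros p t Ht. apply (slope_le Om U Du HU); [easy| |intros; lra].
    intros s _ Ho. replace C with (C * norm4 e) by (rewrite He; ring).
    apply dot4_grad_le. intros i. now apply (gradient_bounded Om U Du _ z i HU). }
  set (eps := eta / (barrier K p0 + 1)).
  assert (HB0 : 0 <= barrier K p0) by now apply barrier_nonneg.
  assert (Heps : 0 < eps) by (apply Rdiv_lt_0_compat; lra).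
  assert (HepsB : eps * barrier K p0 < eta).
  { replace eta with (eps * (barrier K p0 + 1)) by (unfold eps; field; lra). nra. }
  destruct (ln_unbounded (2 * (C / eps))) as (s0 & Hs0).
  set (Rad := Rabs s0 + 1).
  assert (Hfar : forall p, Rad < norm4 p -> C < eps * barrier K p).
  { intros p Hp. pose proof (Rabs_pos s0). pose proof (Rle_abs s0).
    assert (Hd : Rad < dot4 p p) by (rewrite <- norm4_sqr; unfold Rad in *; nra).
    specialize (Hs0 (1 + dot4 p p) ltac:(unfold Rad in *; lra)).
    pose proof (barrier_ge K p HK0).
    apply Rmult_lt_reg_l with (/ eps); [now apply Rinv_0_lt_compat|].
    rewrite <- Rmult_assoc, Rinv_l by lra. unfold Rdiv in Hs0. lra. }
  destruct (uniform_small (fun p t => ~ Om p -> U (ray p t e) <= (1 + eta) * t) (Rad + 1))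
    as (d & Hd & Hsm).
  { intros c. now apply (difference_small Om U Du e eta c HU). }
  destruct (directional_derivative Om U Du (roof_open _ _ _ HU) (roof_part _ _ _ HU)
    (roof_cont1 _ _ _ HU) p0 e Hp0 eta Heta) as ([d' Hd'] & Hder).
  cbn in Hder.
  set (t := Rmin d d' / 2).
  assert (Hmin : 0 < Rmin d d') by now apply Rmin_pos.
  pose proof (Rmin_l d d'). pose proof (Rmin_r d d').
  assert (Ht : 0 < t) by (unfold t; lra).
  specialize (Hder t ltac:(lra) ltac:(rewrite Rabs_right; unfold t; lra)).
  rewrite Rplus_0_l, ray0 in Hder. apply Rabs_def2 in Hder.
  set (w := fun p => / t * (U (add4 p (scal4 t e)) - U p) - eps * barrier K p).
  assert (Hw0 : 1 + eta < w p0).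
  { unfold w. unfold Rdiv in Hder. rewrite (Rmult_comm (/ t)). unfold eta in *. lra. }
  assert (Hwfar : forall p, Rad < norm4 p -> w p < 0).
  { intros p Hp. specialize (Hfar p Hp). unfold w.
    assert (/ t * (U (ray p t e) - U p) <= C); [|lra].
    apply Rmult_le_reg_l with t; [easy|]. rewrite <- Rmult_assoc, Rinv_r by lra.
    specialize (Hlip p t ltac:(lra)). lra. }
  assert (Htr : forall p, cont4 (fun q => U (add4 q (scal4 t e))) p).
  { intros p. apply cont4_pre; [|apply (roof_cont _ _ _ HU)].
    intros q r. unfold dist4. right. f_equal. r4eq. }
  assert (Hp0R : norm4 p0 <= Rad).
  { apply Rnot_lt_le; intros Hp. specialize (Hwfar p0 Hp). lra. }
  (* The ball exceeds by one the radius beyond which [w] is negative, so the maximum point is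
     interior. *)
  destruct (max_attained (fun p => norm4 p <= Rad + 1) (Rad + 1) w p0) as (m & Hm & Hmax).
  - intros p Hp. destruct (closed4_ball (mkR4 0 0 0 0) (Rad + 1) p) as (r & Hr & H').
    + unfold dist4. replace (sub4 p (mkR4 0 0 0 0)) with p by r4eq. easy.
    + exists r. split; [easy|]. intros q Hq. specialize (H' q Hq). unfold dist4 in H'.
      now replace (sub4 q (mkR4 0 0 0 0)) with q in H' by r4eq.
  - easy.
  - lra.
  - intros p _. unfold w.
    repeat first [apply (roof_cont _ _ _ HU) | apply Htr | apply cont4_barrier | cont4_step].
  - assert (Hwm : 1 + eta < w m) by (specialize (Hmax p0 ltac:(lra)); lra).
    assert (HmR : norm4 m <= Rad).
    { apply Rnot_lt_le; intros Hp. specialize (Hwfar m Hp). lra. }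
    assert (HBm : 0 <= eps * barrier K m)
      by (apply Rmult_le_pos; [lra|now apply barrier_nonneg]).
    assert (Hti : 0 < / t) by now apply Rinv_0_lt_compat.
    assert (Hquot : (1 + eta) * t < U (ray m t e) - U m).
    { apply Rmult_lt_reg_l with (/ t); [easy|].
      replace (/ t * ((1 + eta) * t)) with (1 + eta) by (field; lra). unfold w in Hwm. lra. }
    (* A quotient starting outside [Om] is at most [1 + eta] by [Hsm], and one ending outside is not
       positive; so both end points lie in [Om], where [U] is harmonic. *)
    assert (Om1 : Om m).
    { apply NNPP; intros Ho. specialize (Hsm m t ltac:(lra) ltac:(unfold t; lra) Ho).
      pose proof (roof_nonneg _ _ _ m HU). cbv beta in Hsm. lra. }
    assert (Om2 : Om (ray m t e)).
    { apply NNPP; intros Ho. rewrite (roof_zero _ _ _ HU _ Ho) in Hquot.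
      pose proof (roof_nonneg _ _ _ m HU). nra. }
    destruct (barrier_superharmonic K S m HK0 HK (HS m Om1)) as (l & Hl & HlB).
    assert (Hlw : lap w m (/ t * (0 - 0) - eps * l)).
    { apply lap_minus; [apply lap_scal, lap_minus|now apply lap_scal].
      - apply lap_translate. now apply (roof_lap _ _ _ HU).
      - now apply (roof_lap _ _ _ HU). }
    assert (Hlm : local_max w m).
    { exists 1. split; [lra|]. intros q Hq. apply Hmax.
      pose proof (norm4_add (sub4 q m) m). change (norm4 (sub4 q m)) with (dist4 q m) in *.
      replace (add4 (sub4 q m) m) with q in * by r4eq. lra. }
    pose proof (lap_local_max _ _ _ Hlm Hlw). nra.
Qed.

Lemma lipschitz_1 Om U Du S z e p t :
  roof Om U Du -> (forall p, Om p -> x1 p ^ 2 < 4 -> dot4 p p <= S) -> ~ Om z ->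
  norm4 e = 1 -> 0 <= t -> U (ray p t e) <= U p + t.
Proof.
  intros HU HS Hz He Ht. replace t with (1 * t) at 2 by ring.
  apply (slope_le Om U Du HU); [easy| |intros; lra].
  intros s _ Ho. now apply (gradient_le_1 Om U Du S z).
Qed.

(** * Comparison at a boundary point *)

(** Walking back from [q + t n] towards [q], the function falls at a rate of nearly one and cannot
    become negative. *)
Lemma normal_slope_ge Om U Du q n eps :
  roof Om U Du -> boundary4 Om q -> outward_unit_normal Om q (scal4 (-1) n) -> 0 < eps < 1 ->
  exists t0, 0 < t0 /\ forall t, 0 < t < t0 -> (1 - eps) * t <= U (ray q t n).
Proof.
  intros HU Hb Hn Heps.
  destruct (roof_bdry _ _ _ HU q Hb) as (L & HL & HLn).
  assert (EL := boundary_gradient Om U Du q L _ HU Hb Hn HL (HLn _ Hn)).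
  replace (scal4 (-1) (scal4 (-1) n)) with n in EL by r4eq. subst L.
  assert (Hnn : dot4 n n = 1).
  { specialize (HLn _ Hn). rewrite dot4_scal_r in HLn. lra. }
  assert (Hn1 : norm4 n = 1).
  { destruct Hn as [Hn _]. rewrite norm4_scal in Hn.
    unfold Rabs in Hn. destruct (Rcase_abs (-1)); lra. }
  destruct (gradient_near Om Du q n HL (eps / 2)) as (d & Hd & Hg); [lra|].
  destruct (normal_cone Om q _ n Hn) as (t0 & Ht0 & Hc).
  { rewrite dot4_scal_r. lra. }
  exists (Rmin d t0). split; [now apply Rmin_pos|]. intros t Ht.
  pose proof (Rmin_l d t0). pose proof (Rmin_r d t0).
  (* The walk stops short of [q]: outside [Om] the lemma [slope_le] asks for a nonnegative slope. *)
  set (t' := eps / 4 * t). assert (Ht' : 0 < t' < t) by (unfold t'; nra).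
  assert (X : U (ray (ray q t n) (t - t') (scal4 (-1) n))
     <= U (ray q t n) + (- (1 - eps / 2)) * (t - t')).
  { apply (slope_le Om U Du HU); [lra| |].
    - intros s Hs Ho. eapply Rle_trans; [apply Hg; [easy|]|].
      + replace (ray (ray q t n) s (scal4 (-1) n)) with (ray q (t - s) n) by r4eq.
        rewrite dist4_ray, Hn1, Rabs_right; lra.
      + rewrite dot4_scal_r, Hnn, norm4_scal, Hn1.
        unfold Rabs. destruct (Rcase_abs (-1)); lra.
    - intros s Hs Ho. destruct Ho.
      replace (ray (ray q t n) s (scal4 (-1) n)) with (ray q (t - s) n) by r4eq.
      apply Hc. lra. }
  pose proof (roof_nonneg _ _ _ (ray (ray q t n) (t - t') (scal4 (-1) n)) HU).
  unfold t' in *. nra.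
Qed.

(* [F] bounds the distance to the complement along [-n], so [U <= F]; were [F]
   strictly superharmonic, the boundary slope of [U] would be less than one. *)
Lemma no_superharmonic_support Om U Du S z q n F theta rho C :
  roof Om U Du -> (forall p, Om p -> x1 p ^ 2 < 4 -> dot4 p p <= S) -> ~ Om z ->
  boundary4 Om q -> outward_unit_normal Om q (scal4 (-1) n) ->
  (forall p, cont4 F p) -> (forall p t, F (ray p t n) = F p + t) -> F q = 0 ->
  0 < theta -> (forall p, lap F p (- theta)) -> 0 < rho -> 0 < C ->
  (forall p, dist4 p q < rho -> F p <= C * dist4 p q) ->
  (forall p, Om p -> dist4 p q < rho -> 0 < F p) -> False.
Proof.
  intros HU HS Hz Hb Hn HFc HFn HFq Hth HFl Hrho HC HFC HFpos.
  assert (Hn1 : norm4 n = 1).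
  { destruct Hn as [Hn' _]. rewrite norm4_scal in Hn'.
    unfold Rabs in Hn'. destruct (Rcase_abs (-1)); lra. }
  (* Moving back along [n] by [F p <= C * r] must stay in the ball of radius [rho]. *)
  set (r := rho / (2 * (1 + C))).
  assert (Hr : 0 < r) by (apply Rdiv_lt_0_compat; lra).
  assert (Err : r * (1 + C) = rho / 2) by (unfold r; field; lra).
  assert (Hrr : r < rho) by nra.
  assert (HUF : forall p, Om p -> dist4 p q <= r -> U p <= F p).
  { intros p Ho Hp. assert (HF := HFpos p Ho ltac:(lra)).
    assert (HF' := HFC p ltac:(lra)).
    (* This point lies on the zero set of [F], hence outside [Om]; as [U] is 1-Lipschitz,
       [U p <= F p]. *)
    set (p' := ray p (- F p) n).
    assert (Dp' : dist4 p' q < rho).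
    { eapply Rle_lt_trans; [apply dist4_tri with (q := p)|].
      unfold p'. rewrite dist4_ray, Hn1, Rabs_Ropp, Rabs_right by lra.
      assert (C * dist4 p q <= C * r) by (apply Rmult_le_compat_l; lra). nra. }
    assert (Fp' : F p' = 0) by (unfold p'; rewrite HFn; ring).
    assert (Ho' : ~ Om p') by (intros Ho'; specialize (HFpos p' Ho' Dp'); lra).
    replace p with (ray p' (F p) n) at 1 by (unfold p'; r4eq).
    rewrite <- (Rplus_0_l (F p)) at 2. rewrite <- (roof_zero _ _ _ HU p' Ho').
    apply (lipschitz_1 Om U Du S z); auto. lra. }
  (* The correction [M * sqdist q] has Laplacian [theta / 4], less than the
     [(1 - eta) * theta >= theta / 2] it works against. The bound [eta * C <= M * r] makes
     [psi >= F] on the sphere of radius [r]. *)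
  set (M := theta / 32). assert (HM : 0 < M) by (unfold M; lra).
  set (eta := Rmin (/ 2) (M * r / C)).
  assert (Heta : 0 < eta).
  { apply Rmin_pos; [lra|]. apply Rdiv_lt_0_compat; nra. }
  assert (Heta1 : eta <= / 2) by apply Rmin_l.
  assert (Heta2 : eta * C <= M * r).
  { replace (M * r) with (M * r / C * C) by (field; lra).
    apply Rmult_le_compat_r; [lra|apply Rmin_r]. }
  set (psi := fun p => (1 - eta) * F p + M * sqdist q p).
  set (w := fun p => U p - psi p).
  set (K := fun p => dist4 p q <= r /\ 0 <= F p).
  assert (Hle : forall p, K p -> U p <= psi p).
  { intros p Hp.
    destruct (max_attained K (r + norm4 q) w p) as (m & [Hm1 Hm2] & Hmax); [| |easy| |].
    - apply closed4_and; [apply closed4_ball|now apply closed4_ge].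
    - intros x [Hx _]. now apply norm4_ball_bound.
    - intros x _. unfold w, psi.
      repeat first [apply (roof_cont _ _ _ HU) | apply HFc | apply cont4_sqdist | cont4_step].
    - assert (Hmp := Hmax p Hp). cut (w m <= 0); [unfold w in *; lra|].
      apply Rnot_lt_le; intros Hw.
      assert (Hpsi : 0 <= psi m).
      { unfold psi. assert (0 <= sqdist q m) by apply dot4_pos. nra. }
      assert (Hom : Om m).
      { apply NNPP; intros Ho. unfold w in Hw. rewrite (roof_zero _ _ _ HU m Ho) in Hw. lra. }
      assert (HUm := HUF m Hom Hm1). assert (HFm := HFpos m Hom ltac:(lra)).
      destruct (Req_dec (dist4 m q) r) as [E|E].
      { assert (HCm := HFC m ltac:(lra)). unfold w, psi in Hw.
        rewrite sqdist_dist4, E in Hw. rewrite E in HCm.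
        assert (eta * F m <= eta * (C * r)) by (apply Rmult_le_compat_l; lra). nra. }
      assert (Hlm : local_max w m).
      { destruct (HFc m (F m) HFm) as (d & Hd & Hd').
        exists (Rmin d (r - dist4 m q)). split; [apply Rmin_pos; lra|].
        intros x Hx. apply Hmax.
        pose proof (Rmin_l d (r - dist4 m q)). pose proof (Rmin_r d (r - dist4 m q)).
        split.
        - pose proof (dist4_tri x m q). lra.
        - specialize (Hd' x ltac:(lra)). apply Rabs_def2 in Hd'. lra. }
      assert (Hlw : lap w m (0 - ((1 - eta) * - theta + M * 8))).
      { apply lap_minus; [now apply (roof_lap _ _ _ HU)|].
        apply lap_plus; apply lap_scal; [apply HFl|]. eapply jet_lap, jet_sqdist. }
      pose proof (lap_local_max _ _ _ Hlm Hlw). unfold M in *. nra. }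
  (* Along the normal, [(1 - eta / 2) * t <= U <= (1 - eta) * t + M * t ^ 2] fails for small [t]. *)
  destruct (normal_slope_ge Om U Du q n (eta / 2) HU Hb Hn) as (t0 & Ht0 & Hlow); [lra|].
  set (t := Rmin (Rmin t0 r) (eta / (2 * M)) / 2).
  assert (Hmin : 0 < Rmin (Rmin t0 r) (eta / (2 * M))).
  { repeat apply Rmin_pos; try easy. apply Rdiv_lt_0_compat; lra. }
  pose proof (Rmin_l (Rmin t0 r) (eta / (2 * M))).
  pose proof (Rmin_r (Rmin t0 r) (eta / (2 * M))).
  pose proof (Rmin_l t0 r). pose proof (Rmin_r t0 r).
  assert (Ht : 0 < t) by (unfold t; lra).
  specialize (Hlow t ltac:(unfold t in *; lra)).
  assert (Dt : dist4 (ray q t n) q = t) by (rewrite dist4_ray, Hn1, Rabs_right; lra).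
  assert (Ft : F (ray q t n) = t) by (rewrite HFn, HFq; ring).
  assert (Hup := Hle (ray q t n)). unfold K, psi in Hup.
  rewrite sqdist_dist4, Dt, Ft in Hup.
  assert (HtM : t * M < eta / 2).
  { apply Rlt_le_trans with (eta / (2 * M) * M); [|right; field; lra].
    apply Rmult_lt_compat_r; [lra|]. unfold t in *. lra. }
  specialize (Hup ltac:(unfold t in *; lra)). nra.
Qed.

(** * Geometry of the rotated graph *)

Lemma exterior_ball Om q : ~ Om q -> ~ boundary4 Om q ->
  exists d, 0 < d /\ forall p, dist4 p q < d -> ~ Om p.
Proof.
  intros Hq Hb. apply NNPP; intros Hno. apply Hb. intros d Hd. split.
  - apply NNPP; intros Hn. apply Hno. exists d. split; [easy|]. intros p Hp Ho.
    apply Hn. now exists p.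
  - exists q. now rewrite dist4_refl.
Qed.

Lemma roof_of_roof_function Om u :
  open4 Om -> (forall q, boundary4 Om q -> exists nu, outward_unit_normal Om q nu) ->
  roof_function Om u -> exists U Du, roof Om U Du.
Proof.
  intros Ho Hnu (Du & D2u & Hpos & Hp1 & Hp2 & Hc1 & _ & Hlap & Hbd).
  set (U := fun p => if excluded_middle_informative (Om p) then u p else 0).
  assert (Uin : forall p, Om p -> U p = u p).
  { intros p Hp. unfold U. now destruct (excluded_middle_informative (Om p)). }
  assert (Uout : forall p, ~ Om p -> U p = 0).
  { intros p Hp. unfold U. now destruct (excluded_middle_informative (Om p)). }
  assert (HP : forall i p, Om p -> has_partial i U p (Du i p)).
  { intros i p Hp. apply is_derive_Reals.
    apply is_derive_ext_loc with (fun t => u (ray p t (e4 i))).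
    - destruct (Ho p Hp) as (r & Hr & H). exists (mkposreal r Hr). intros t Ht.
      symmetry. apply Uin, H. rewrite dist4_ray, norm4_e4, Rmult_1_r.
      unfold ball in Ht; cbn in Ht. unfold AbsRing_ball, abs, minus, plus, opp in Ht; cbn in Ht.
      now rewrite Ropp_0, Rplus_0_r in Ht.
    - now apply is_derive_Reals, Hp1. }
  assert (HC1 : forall i p, Om p -> cont4 (Du i) p).
  { intros i p Hp eps He. destruct (Ho p Hp) as (r & Hr & H).
    destruct (Hc1 i p Hp eps He) as (d & Hd & H1). exists (Rmin d r).
    split; [now apply Rmin_pos|]. intros q Hq. apply H1.
    - apply H. eapply Rlt_le_trans; [exact Hq|apply Rmin_r].
    - eapply Rlt_le_trans; [exact Hq|apply Rmin_l]. }
  exists U, Du. constructor.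
  - easy.
  - intros p. destruct (classic (Om p)) as [Hp|Hp]; [now apply (C1_continuous Om U Du)|].
    intros eps He. rewrite (Uout p Hp).
    destruct (classic (boundary4 Om p)) as [Hb|Hb].
    + destruct (proj1 (Hbd p Hb) eps He) as (d & Hd & H). exists d. split; [easy|].
      intros q Hq. destruct (classic (Om q)) as [Hoq|Hoq].
      * rewrite Uin by easy. now apply H.
      * rewrite Uout, Rminus_0_r, Rabs_R0 by easy. easy.
    + destruct (exterior_ball Om p Hp Hb) as (d & Hd & H). exists d. split; [easy|].
      intros q Hq. rewrite Uout, Rminus_0_r, Rabs_R0 by now apply H. easy.
  - intros p Hp. rewrite Uin by easy. now apply Hpos.
  - easy.
  - easy.
  - easy.
  - intros p Hp. exists (fun i => D2u i i p). split; [|now apply Hlap].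
    intros i. destruct (Ho p Hp) as (r & Hr & H).
    exists (fun t => Du i (ray p t (e4 i))), r. split; [easy|]. split.
    + intros t Ht. apply has_partial_ray, HP, H. now rewrite dist4_ray, norm4_e4, Rmult_1_r.
    + exact (Hp2 i i p Hp).
  - easy.
  - intros q Hq. destruct (Hbd q Hq) as (_ & L & HL & HLn).
    exists (mkR4 (L I1) (L I2) (L I3) (L I4)). split.
    + intros i. destruct i; apply HL.
    + intros nu H. specialize (HLn nu H). unfold dot4; cbn. lra.
Qed.

Definition radius (p : R4) : R := sqrt (x2 p ^ 2 + x3 p ^ 2 + x4 p ^ 2).

Lemma radius_sqr p : radius p * radius p = x2 p ^ 2 + x3 p ^ 2 + x4 p ^ 2.
Proof. apply sqrt_sqrt. nra. Qed.

Lemma radius_pos p : 0 <= radius p.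
Proof. apply sqrt_pos. Qed.

Lemma radius_ge p v : 0 <= v -> v * v <= x2 p ^ 2 + x3 p ^ 2 + x4 p ^ 2 -> v <= radius p.
Proof. intros Hv H. rewrite <- (sqrt_square v Hv). now apply sqrt_le_1_alt. Qed.

Lemma radius_le p v : 0 <= v -> x2 p ^ 2 + x3 p ^ 2 + x4 p ^ 2 <= v * v -> radius p <= v.
Proof. intros Hv H. rewrite <- (sqrt_square v Hv). now apply sqrt_le_1_alt. Qed.

Lemma cont4_radius p : cont4 radius p.
Proof.
  apply (cont4_comp sqrt (fun q => x2 q ^ 2 + x3 q ^ 2 + x4 q ^ 2)).
  - apply continuity_pt_sqrt. nra.
  - repeat cont4_step.
Qed.

Definition rot_defining (g : R -> R) (p : R4) : R := radius p - g (x1 p).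

Lemma rot_domain_iff g p : rot_domain g p <-> rot_defining g p < 0.
Proof. unfold rot_domain, rot_defining. fold (radius p). split; lra. Qed.

Lemma cont4_rot_defining g p : continuity g -> cont4 (rot_defining g) p.
Proof.
  intros Hg. unfold rot_defining. apply cont4_minus; [apply cont4_radius|].
  apply (cont4_comp g x1); [apply Hg|repeat cont4_step].
Qed.

Lemma rot_domain_open g : continuity g -> open4 (rot_domain g).
Proof.
  intros Hg p Hp. apply rot_domain_iff in Hp.
  destruct (cont4_rot_defining g p Hg (- rot_defining g p)) as (d & Hd & H); [lra|].
  exists d. split; [easy|]. intros q Hq. apply rot_domain_iff.
  specialize (H q Hq). apply Rabs_def2 in H. lra.
Qed.

Lemma rot_domain_boundary g q :
  continuity g -> boundary4 (rot_domain g) q -> radius q = g (x1 q).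
Proof.
  intros Hg Hb.
  destruct (Req_dec (rot_defining g q) 0) as [E|E]; [unfold rot_defining in E; lra|].
  exfalso.
  destruct (cont4_rot_defining g q Hg (Rabs (rot_defining g q))) as (d & Hd & H).
  { now apply Rabs_pos_lt. }
  destruct (Hb d Hd) as ((p & Hp & Dp) & (p' & Hp' & Dp')).
  rewrite rot_domain_iff in Hp, Hp'. apply H in Dp. apply H in Dp'.
  unfold Rabs at 2 in Dp. unfold Rabs at 2 in Dp'.
  destruct (Rcase_abs (rot_defining g q)); apply Rabs_def2 in Dp; apply Rabs_def2 in Dp'; lra.
Qed.

(** The normalized gradient of [rot_defining g] at [q], with [g1] for the derivative of [g] at
    [x1 q]. *)
Definition rot_normal (q : R4) (g1 : R) : R4 :=
  scal4 (/ sqrt (1 + g1 ^ 2)) (mkR4 (- g1) (x2 q / radius q) (x3 q / radius q) (x4 q / radius q)).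

(** Near [q], [rot_defining g] differs from [N] times the normal component of [p - q] by at most
    [eps / 2 * d], half from the derivative of [g] and half from the radius; and [N >= 1]. *)
Lemma rot_domain_normal g q g1 :
  radius q = g (x1 q) -> 0 < radius q -> derivable_pt_lim g (x1 q) g1 ->
  outward_unit_normal (rot_domain g) q (rot_normal q g1).
Proof.
  intros Eq Hy Dg. set (y := radius q) in *.
  set (N := sqrt (1 + g1 ^ 2)).
  assert (HNN : N * N = 1 + g1 ^ 2) by (apply sqrt_sqrt; nra).
  assert (HN0 : 0 <= N) by apply sqrt_pos.
  assert (HN : 1 <= N) by nra.
  assert (Hyy : x2 q ^ 2 + x3 q ^ 2 + x4 q ^ 2 = y * y) by (symmetry; apply radius_sqr).
  split.
  { unfold rot_normal. fold y N. rewrite norm4_scal.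
    assert (E : norm4 (mkR4 (- g1) (x2 q / y) (x3 q / y) (x4 q / y)) = N).
    { unfold norm4, N. f_equal. unfold dot4; cbn -[pow].
      replace (- g1 * - g1 + x2 q / y * (x2 q / y) + x3 q / y * (x3 q / y) + x4 q / y * (x4 q / y))
        with (g1 ^ 2 + (x2 q ^ 2 + x3 q ^ 2 + x4 q ^ 2) / (y * y)) by (field; lra).
      rewrite Hyy. field. lra. }
    rewrite E, Rabs_right by (apply Rle_ge, Rlt_le, Rinv_0_lt_compat; lra).
    apply Rinv_l. lra. }
  intros eps He.
  destruct (Dg (eps / 4)) as ([d1 Hd1] & H1); [lra|]. cbn in H1.
  exists (Rmin d1 (Rmin y (y * (eps / 2)))).
  split. { repeat apply Rmin_pos; try easy. nra. }
  intros p Hp.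
  pose proof (Rmin_l d1 (Rmin y (y * (eps / 2)))). pose proof (Rmin_r d1 (Rmin y (y * (eps / 2)))).
  pose proof (Rmin_l y (y * (eps / 2))). pose proof (Rmin_r y (y * (eps / 2))).
  set (d := dist4 p q) in *. assert (Hd0 : 0 <= d) by apply dist4_pos.
  set (xi := x1 p - x1 q).
  assert (Hxi : Rabs xi <= d) by apply (coord_le_norm4 I1 (sub4 p q)).
  assert (Hg : Rabs (g (x1 p) - y - g1 * xi) <= eps / 4 * d).
  { destruct (Req_dec xi 0) as [E|E].
    - replace (x1 p) with (x1 q) by (unfold xi in E; lra). rewrite E, <- Eq.
      replace (y - y - g1 * 0) with 0 by ring. rewrite Rabs_R0. nra.
    - specialize (H1 xi E ltac:(lra)).
      replace (x1 q + xi) with (x1 p) in H1 by (unfold xi; ring). rewrite <- Eq in H1.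
      replace (g (x1 p) - y - g1 * xi) with (((g (x1 p) - y) / xi - g1) * xi) by (field; easy).
      rewrite Rabs_mult. apply Rmult_le_compat; auto using Rabs_pos. now apply Rlt_le. }
  apply Rabs_le_between in Hg.
  (* The first-order change of the radius; the remainder [Y] in the expansion [Ep] of its square is
     quadratic in [d]. *)
  set (b := ((x2 p - x2 q) * x2 q + (x3 p - x3 q) * x3 q + (x4 p - x4 q) * x4 q) / y).
  assert (Edot : dot4 (sub4 p q) (rot_normal q g1) * N = - g1 * xi + b).
  { unfold rot_normal, b, xi. fold y N. unfold dot4; cbn. field. lra. }
  set (D := dot4 (sub4 p q) (rot_normal q g1)) in *.
  set (Y := (x2 p - x2 q) ^ 2 + (x3 p - x3 q) ^ 2 + (x4 p - x4 q) ^ 2).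
  assert (HY : Y <= d * d).
  { unfold d. rewrite <- sqdist_dist4. pose proof (pow2_ge_0 (x1 p - x1 q)).
    unfold Y, sqdist, dot4; cbn [x1 x2 x3 x4 sub4]. lra. }
  assert (HY0 : 0 <= Y).
  { pose proof (pow2_ge_0 (x2 p - x2 q)). pose proof (pow2_ge_0 (x3 p - x3 q)).
    pose proof (pow2_ge_0 (x4 p - x4 q)). unfold Y. lra. }
  assert (Ep : x2 p ^ 2 + x3 p ^ 2 + x4 p ^ 2 = y * y + 2 * y * b + Y).
  { unfold b, Y. rewrite <- Hyy. field. lra. }
  assert (Hb2 : b * b <= Y).
  { assert (Eb : b * y = (x2 p - x2 q) * x2 q + (x3 p - x3 q) * x3 q + (x4 p - x4 q) * x4 q)
      by (unfold b; field; lra).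
    assert (C : (b * y) * (b * y) <= Y * (y * y)).
    { rewrite Eb, <- Hyy. unfold Y.
      set (u := x2 p - x2 q). set (v := x3 p - x3 q). set (w := x4 p - x4 q).
      apply Rminus_le.
      replace (_ - _) with (- ((u * x3 q - v * x2 q) ^ 2 + (u * x4 q - w * x2 q) ^ 2
        + (v * x4 q - w * x3 q) ^ 2)) by ring.
      pose proof (pow2_ge_0 (u * x3 q - v * x2 q)). pose proof (pow2_ge_0 (u * x4 q - w * x2 q)).
      pose proof (pow2_ge_0 (v * x4 q - w * x3 q)). lra. }
    apply Rmult_le_reg_r with (y * y); [nra|]. lra. }
  assert (Hbd : - d <= b) by nra.
  assert (Hlo : y + b <= radius p) by (apply radius_ge; [lra|nra]).
  assert (Hup : radius p <= y + b + eps / 4 * d).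
  { apply Rle_trans with (y + b + Y / (2 * y)).
    - assert (Hq : 0 <= Y / (2 * y)).
      { apply Rmult_le_pos; [easy|]. apply Rlt_le, Rinv_0_lt_compat. lra. }
      assert (E2 : y * (Y / (2 * y)) = Y / 2) by (field; lra).
      apply radius_le; [lra|]. rewrite Ep.
      pose proof (pow2_ge_0 (b + Y / (2 * y))). nra.
    - apply Rplus_le_compat_l. apply Rmult_le_reg_r with (2 * y); [lra|].
      replace (Y / (2 * y) * (2 * y)) with Y by (field; lra). nra. }
  rewrite rot_domain_iff. unfold rot_defining. split.
  - intros HD. assert (Hd : 0 < d).
    { destruct Hd0 as [|E]; [easy|]. pose proof (cauchy_schwarz4 (sub4 p q) (rot_normal q g1)) as C.
      change (norm4 (sub4 p q)) with d in C. fold D in C. rewrite <- E in *.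
      apply Rabs_le_between in C. lra. }
    assert (D * N < - eps * d).
    { assert (0 < eps * d) by nra. nra. }
    nra.
  - intros HD Hin.
    assert (eps * d < D * N).
    { assert (0 <= eps * d) by nra. nra. }
    nra.
Qed.

Lemma rot_domain_bdry_point g x :
  continuity g -> 0 < g x -> boundary4 (rot_domain g) (mkR4 x (g x) 0 0).
Proof.
  intros Hg Hx d Hd.
  assert (Hrad : forall v, 0 <= v -> radius (mkR4 x v 0 0) = v).
  { intros v Hv. unfold radius; cbn [x2 x3 x4].
    replace (v ^ 2 + 0 ^ 2 + 0 ^ 2) with (v * v) by ring. now apply sqrt_square. }
  split.
  - pose proof (Rmin_l (g x) (d / 2)). pose proof (Rmin_r (g x) (d / 2)).
    assert (0 < Rmin (g x) (d / 2)) by (apply Rmin_pos; lra).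
    exists (mkR4 x (g x - Rmin (g x) (d / 2)) 0 0). split.
    + apply rot_domain_iff. unfold rot_defining. rewrite Hrad by lra. cbn. lra.
    + eapply Rle_lt_trans; [apply dist4_sum_coord|]. cbn.
      rewrite !Rminus_diag, !Rabs_R0.
      replace (g x - Rmin (g x) (d / 2) - g x) with (- Rmin (g x) (d / 2)) by ring.
      rewrite Rabs_Ropp, Rabs_right by lra. lra.
  - exists (mkR4 x (g x) 0 0). split; [|now rewrite dist4_refl].
    rewrite rot_domain_iff. unfold rot_defining. rewrite Hrad by lra. cbn. lra.
Qed.

(** * The curvature inequality *)

Lemma real_analytic_C2 g : real_analytic g -> exists g1 g2,
  (forall x, derivable_pt_lim g x (g1 x)) /\ (forall x, derivable_pt_lim g1 x (g2 x)).
Proof.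
  intros Han.
  assert (H : forall x, ex_derive_n g 1 x /\ ex_derive_n g 2 x).
  { intros x. destruct (Han x) as (r & Hr & a & Ha).
    assert (Hs : forall y, Rabs (y - x) < r -> is_series (fun n => a n * (y - x) ^ n) (g y)).
    { intros y Hy. apply is_series_Reals. intros eps He.
      destruct (Ha y Hy eps He) as (N & HN). exists N. intros n Hn. now apply HN. }
    assert (HP : forall y, Rabs (y - x) < r -> PSeries a (y - x) = g y).
    { intros y Hy. unfold PSeries. now apply is_series_unique, Hs. }
    (* Convergence at the single point [x + r / 2] already bounds the radius of convergence below by
       [r / 2]. *)
    assert (HR : Rbar_lt (Rabs (x - x)) (CV_radius a)).
    { apply Rbar_lt_le_trans with (r / 2).
      - rewrite Rminus_diag, Rabs_R0. cbn. lra.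
      - apply Rbar_not_lt_le. intros Hlt.
        apply (CV_disk_outside a (r / 2)).
        + rewrite Rabs_right by lra. exact Hlt.
        + apply ex_series_lim_0. exists (g (x + r / 2)).
          assert (X := Hs (x + r / 2)). replace (x + r / 2 - x) with (r / 2) in X by ring.
          apply X. rewrite Rabs_right; lra. }
    assert (L : locally x (fun y => PSeries a (y - x) = g y)).
    { exists (mkposreal r Hr). intros y Hy. apply HP. exact Hy. }
    split; apply (ex_derive_n_ext_loc _ _ _ _ L);
      apply (ex_derive_n_comp_trans (PSeries a) _ x (- x)), ex_derive_n_PSeries; exact HR. }
  exists (Derive g), (Derive (Derive g)). split; intros x; apply is_derive_Reals, Derive_correct.
  - apply (proj1 (H x)).
  - apply (proj2 (H x)).
Qed.

Lemma taylor2_upper g g1 c x eps :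
  (forall y, derivable_pt_lim g y (g1 y)) -> derivable_pt_lim g1 x c -> 0 < eps ->
  exists d, 0 < d /\ forall h, Rabs h < d -> g (x + h) <= g x + g1 x * h + / 2 * (c + eps) * h ^ 2.
Proof.
  intros Hg Hg1 He. destruct (Hg1 eps He) as ([d Hd] & H). cbn in H.
  exists d. split; [easy|]. intros h Hh.
  (* Near zero the derivative of [phi] has the sign opposite to [s], so [phi] is largest at zero. *)
  set (phi := fun s => g (x + s) - g1 x * s - / 2 * (c + eps) * s ^ 2).
  destruct (MVT_gen phi 0 h (fun s => g1 (x + s) - g1 x - (c + eps) * s)) as (s & Hs & E).
  - intros s _. unfold phi. auto_derive.
    + exists (g1 (x + s)). now apply is_derive_Reals.
    + replace (Derive (fun y => g y) (x + s)) with (g1 (x + s)); [field|].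
      symmetry. now apply is_derive_unique, is_derive_Reals.
  - intros s _. apply derivable_continuous_pt. unfold phi. apply ex_derive_Reals_0.
    auto_derive. exists (g1 (x + s)). now apply is_derive_Reals.
  - rewrite Rminus_0_r in E.
    assert (Hle : (g1 (x + s) - g1 x - (c + eps) * s) * h <= 0).
    { destruct (Req_dec s 0) as [->|Hs0].
      - rewrite Rplus_0_r. right. ring.
      - assert (Hsd : Rabs s < d).
        { eapply Rle_lt_trans; [|exact Hh]. unfold Rmin, Rmax in Hs.
          destruct (Rle_dec 0 h); [rewrite !Rabs_right|rewrite !Rabs_left1]; lra. }
        specialize (H s Hs0 Hsd). apply Rabs_def2 in H.
        set (Q := (g1 (x + s) - g1 x) / s) in *.
        replace (g1 (x + s) - g1 x - (c + eps) * s) with ((Q - c - eps) * s)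
          by (unfold Q; field; easy).
        assert (0 <= s * h).
        { unfold Rmin, Rmax in Hs. destruct (Rle_dec 0 h); nra. }
        nra. }
    rewrite <- E in Hle. unfold phi in Hle. rewrite Rplus_0_r in Hle. lra.
Qed.

(* Rewrites a second order bound over the tangent abscissa [N xi = s + P t] as a
   bound over the tangential coordinate [s] alone, at the price of [eps]. *)
Lemma tangential_absorb a b eps P s t S2 d :
  0 < eps -> 0 <= S2 -> Rabs s <= d -> Rabs t <= d ->
  Rabs (a + eps / 2) * (Rabs P + P ^ 2) * d <= / 2 ->
  Rabs (a + eps / 2) * (Rabs P + P ^ 2) * d * (Rabs a + Rabs b) <= eps / 2 ->
  / 2 * (b + eps / 2) * S2 + / 2 * (a + eps / 2) * (s + P * t) ^ 2 < t ->
  / 2 * a * s ^ 2 + / 2 * b * S2 < t.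
Proof.
  intros He HS Hs Ht G1 G2 H.
  set (a' := a + eps / 2) in *.
  set (k := a' * P * s + / 2 * a' * P ^ 2 * t).
  set (E := / 2 * a * s ^ 2 + / 2 * b * S2).
  set (G := Rabs a' * (Rabs P + P ^ 2) * d) in *.
  assert (Hk : Rabs k <= G).
  { unfold k. eapply Rle_trans; [apply Rabs_triang|].
    rewrite !Rabs_mult, (Rabs_right (/ 2)), (Rabs_right (P ^ 2)) by (apply Rle_ge; first [apply pow2_ge_0 | lra]).
    pose proof (Rabs_pos a'). pose proof (Rabs_pos P). pose proof (pow2_ge_0 P).
    pose proof (Rabs_pos t).
    assert (Rabs a' * Rabs P * Rabs s <= Rabs a' * Rabs P * d)
      by (apply Rmult_le_compat_l; [now apply Rmult_le_pos|easy]).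
    assert (Rabs a' * P ^ 2 * Rabs t <= Rabs a' * P ^ 2 * d)
      by (apply Rmult_le_compat_l; [now apply Rmult_le_pos|easy]).
    assert (0 <= Rabs a' * P ^ 2 * Rabs t) by (apply Rmult_le_pos; [now apply Rmult_le_pos|easy]).
    unfold G. lra. }
  assert (HE : Rabs E <= / 2 * (Rabs a + Rabs b) * (s ^ 2 + S2)).
  { unfold E. eapply Rle_trans; [apply Rabs_triang|].
    rewrite !Rabs_mult, (Rabs_right (/ 2)), (Rabs_right (s ^ 2)), (Rabs_right S2) by (apply Rle_ge; first [apply pow2_ge_0 | lra]).
    pose proof (Rabs_pos a). pose proof (Rabs_pos b). pose proof (pow2_ge_0 s). nra. }
  assert (HkE : - (eps / 4 * (s ^ 2 + S2)) <= k * E).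
  { assert (X : Rabs (k * E) <= eps / 4 * (s ^ 2 + S2)).
    { rewrite Rabs_mult.
      apply Rle_trans with (G * (/ 2 * (Rabs a + Rabs b) * (s ^ 2 + S2))).
      - apply Rmult_le_compat; auto using Rabs_pos.
      - pose proof (pow2_ge_0 s).
        replace (G * (/ 2 * (Rabs a + Rabs b) * (s ^ 2 + S2)))
          with ((G * (Rabs a + Rabs b)) * (/ 2 * (s ^ 2 + S2))) by ring.
        apply Rle_trans with (eps / 2 * (/ 2 * (s ^ 2 + S2))); [|lra].
        apply Rmult_le_compat_r; lra. }
    apply Rabs_le_between in X. lra. }
  apply Rabs_le_between in Hk.
  assert (Hm : (1 - k) * E < (1 - k) * t).
  { replace ((1 - k) * t) with (t - / 2 * a' * (s + P * t) ^ 2 + / 2 * a' * s ^ 2)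
      by (unfold k; field).
    unfold a' in *. unfold E in *. nra. }
  apply Rmult_lt_reg_l with (1 - k); [lra|easy].
Qed.

(** A quadratic model of the distance to the boundary near [(x0, y0, 0, 0)], in the orthonormal
    frame of the inward normal [(P, -1) / N], the tangent [(1, P) / N] of the profile, and the last
    two axes. The numbers [a] and [b] stand for the curvatures of the profile and of the rotation;
    the model is affine with slope one along the normal. *)
Definition support (x0 y0 P N a b : R) (p : R4) : R :=
  let xi := x1 p - x0 in let et := x2 p - y0 in
  (P * xi - et) / N - (/ 2 * a * ((xi + P * et) / N) ^ 2 + / 2 * b * (x3 p ^ 2 + x4 p ^ 2)).

Lemma lap_support x0 y0 P N a b p :
  0 < N -> N * N = 1 + P ^ 2 -> lap (support x0 y0 P N a b) p (- (a + 2 * b)).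
Proof.
  intros HN HNN.
  set (v := mkR4 (P / N) (- / N) 0 0). set (w := mkR4 (/ N) (P / N) 0 0).
  eapply jet_lap, jet_eq.
  - apply jet_ext with (fun q => (dot4 v q + (y0 - P * x0) / N) +
      ((- (/ 2 * a)) * ((dot4 w q + - (x0 + P * y0) / N) * (dot4 w q + - (x0 + P * y0) / N))
       + (- (/ 2 * b)) * ((dot4 (e4 I3) q + 0) * (dot4 (e4 I3) q + 0)
                 + (dot4 (e4 I4) q + 0) * (dot4 (e4 I4) q + 0)))).
    + intros q. unfold support, v, w, dot4; cbn. field. lra.
    + apply jet_plus; [apply jet_affine|]. apply jet_plus; apply jet_scal.
      * apply jet_mult; apply jet_affine.
      * apply jet_plus; apply jet_mult; apply jet_affine.
  - reflexivity.
  - assert (E : dot4 w w = 1).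
    { transitivity ((1 + P ^ 2) / (N * N)); [unfold w, dot4; cbn; field; lra|].
      rewrite HNN. field. nra. }
    assert (E3 : dot4 (e4 I3) (e4 I3) = 1) by (unfold dot4; cbn; ring).
    assert (E4 : dot4 (e4 I4) (e4 I4) = 1) by (unfold dot4; cbn; ring).
    rewrite E, E3, E4. field. lra.
Qed.

(** After squaring, the condition on [c0] is what is left. It holds near [et = 0], [S2 = 0] as soon
    as [c0] is below [/ (2 * y0)]. *)
Lemma radius_lower y0 et S2 c0 p :
  x2 p = y0 + et -> x3 p ^ 2 + x4 p ^ 2 = S2 -> 2 * c0 * (y0 + et) + c0 ^ 2 * S2 <= 1 ->
  y0 + et + c0 * S2 <= radius p.
Proof.
  intros E2 ES Hc. assert (HS : 0 <= S2) by (rewrite <- ES; nra).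
  destruct (Rle_lt_dec (y0 + et + c0 * S2) 0) as [Hle|Hlt].
  - eapply Rle_trans; [exact Hle|apply radius_pos].
  - apply radius_ge; [lra|]. rewrite E2.
    apply Rle_trans with ((y0 + et) ^ 2 + S2 * (2 * c0 * (y0 + et) + c0 ^ 2 * S2)); [right; ring|].
    nra.
Qed.

(** With both curvatures lowered by [eps], the zero set of the model touches the boundary from
    outside the domain. Half of [eps] pays for the Taylor bound on [g] and the bound on the radius,
    the other half for passing to tangential coordinates in [tangential_absorb]. *)
Lemma support_positive g g1 g2 x0 :
  (forall x, 0 < g x) -> (forall x, derivable_pt_lim g x (g1 x)) ->
  derivable_pt_lim g1 x0 g2 ->
  forall N a b eps, 0 < N -> N * N = 1 + g1 x0 ^ 2 -> 0 < eps ->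
  a + eps = - g2 / N ^ 3 -> b + eps = / (g x0 * N) ->
  exists rho, 0 < rho /\ forall p, rot_domain g p -> dist4 p (mkR4 x0 (g x0) 0 0) < rho ->
    0 < support x0 (g x0) (g1 x0) N a b p.
Proof.
  intros Hpos Hg Hg1 N a b eps HN HNN He Ea Eb.
  set (y0 := g x0) in *. set (P := g1 x0) in *.
  assert (Hy : 0 < y0) by apply Hpos.
  assert (HN3 : 0 < N ^ 3) by now apply pow_lt.
  destruct (taylor2_upper g g1 g2 x0 (N ^ 3 * eps / 2) Hg Hg1) as (d1 & Hd1 & HT); [nra|].
  fold y0 P in HT.
  set (c0 := (b + eps / 2) * N / 2).
  assert (Ec0 : 2 * c0 * y0 = 1 - eps * N * y0 / 2).
  { unfold c0. replace (b + eps / 2) with (/ (y0 * N) - eps / 2) by lra. field. lra. }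
  set (G := Rabs (a + eps / 2) * (Rabs P + P ^ 2)).
  assert (HG : 0 <= G).
  { apply Rmult_le_pos; [apply Rabs_pos|]. pose proof (Rabs_pos P). pose proof (pow2_ge_0 P). lra. }
  set (W := Rabs a + Rabs b). assert (HW : 0 <= W).
  { pose proof (Rabs_pos a). pose proof (Rabs_pos b). unfold W. lra. }
  set (C := 2 * Rabs c0 + c0 ^ 2). assert (HC : 0 <= C).
  { pose proof (Rabs_pos c0). pose proof (pow2_ge_0 c0). unfold C. lra. }
  assert (HeN : 0 < eps * N * y0 / 2) by (assert (0 < eps * N) by nra; nra).
  (* The radius [r2] serves [radius_lower]; [r3] and [r4] serve the two smallness conditions of
     [tangential_absorb]. *)
  set (r2 := eps * N * y0 / 2 / (C + 1)).
  set (r3 := / 2 / (G + 1)). set (r4 := eps / 2 / (G * W + 1)).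
  assert (HGW : 0 <= G * W) by now apply Rmult_le_pos.
  assert (Hr2 : 0 < r2) by (apply Rdiv_lt_0_compat; lra).
  assert (Hr3 : 0 < r3) by (apply Rdiv_lt_0_compat; lra).
  assert (Hr4 : 0 < r4) by (apply Rdiv_lt_0_compat; lra).
  exists (Rmin (Rmin 1 d1) (Rmin r2 (Rmin r3 r4))).
  split. { repeat apply Rmin_pos; lra. }
  intros p Hp Hd.
  set (q := mkR4 x0 y0 0 0) in *. set (d := dist4 p q) in *.
  pose proof (Rmin_l (Rmin 1 d1) (Rmin r2 (Rmin r3 r4))).
  pose proof (Rmin_r (Rmin 1 d1) (Rmin r2 (Rmin r3 r4))).
  pose proof (Rmin_l 1 d1). pose proof (Rmin_r 1 d1).
  pose proof (Rmin_l r2 (Rmin r3 r4)). pose proof (Rmin_r r2 (Rmin r3 r4)).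
  pose proof (Rmin_l r3 r4). pose proof (Rmin_r r3 r4).
  assert (Hd0 : 0 <= d) by apply dist4_pos.
  assert (B2 : C * d <= eps * N * y0 / 2).
  { replace (eps * N * y0 / 2) with ((C + 1) * r2) by (unfold r2; field; lra). nra. }
  assert (B3 : G * d <= / 2).
  { replace (/ 2) with ((G + 1) * r3) by (unfold r3; field; lra). nra. }
  assert (B4 : G * d * W <= eps / 2).
  { replace (eps / 2) with ((G * W + 1) * r4) by (unfold r4; field; lra). nra. }
  set (xi := x1 p - x0). set (et := x2 p - y0). set (S2 := x3 p ^ 2 + x4 p ^ 2).
  assert (Hxi : Rabs xi <= d) by apply (coord_le_norm4 I1 (sub4 p q)).
  assert (Het : Rabs et <= d) by apply (coord_le_norm4 I2 (sub4 p q)).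
  assert (HS0 : 0 <= S2) by (unfold S2; nra).
  assert (Hdd : xi ^ 2 + et ^ 2 + S2 = d * d).
  { unfold d. rewrite <- sqdist_dist4. unfold xi, et, S2, sqdist, q, dot4; cbn. ring. }
  assert (HSd : S2 <= d).
  { pose proof (pow2_ge_0 xi). pose proof (pow2_ge_0 et). nra. }
  set (s := (xi + P * et) / N). set (t := (P * xi - et) / N).
  assert (Est : s ^ 2 + t ^ 2 = xi ^ 2 + et ^ 2).
  { transitivity ((1 + P ^ 2) * (xi ^ 2 + et ^ 2) / (N * N)); [unfold s, t; field; lra|].
    rewrite HNN. field. nra. }
  assert (Hs : Rabs s <= d) by (apply Rabs_le_between; pose proof (pow2_ge_0 t); split; nra).
  assert (Ht : Rabs t <= d) by (apply Rabs_le_between; pose proof (pow2_ge_0 s); split; nra).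
  assert (Exi : N * xi = s + P * t).
  { transitivity (xi * (1 + P ^ 2) / N); [rewrite <- HNN; field; lra|].
    unfold s, t. field. lra. }
  assert (Hrad : y0 + et + c0 * S2 <= radius p).
  { apply radius_lower; [unfold et; ring|easy|].
    assert (2 * c0 * et <= 2 * Rabs c0 * d).
    { assert (c0 * et <= Rabs c0 * d); [|lra].
      eapply Rle_trans; [apply Rle_abs|]. rewrite Rabs_mult.
      apply Rmult_le_compat_l; [apply Rabs_pos|easy]. }
    assert (c0 ^ 2 * S2 <= c0 ^ 2 * d) by (apply Rmult_le_compat_l; [apply pow2_ge_0|easy]).
    unfold C in B2. lra. }
  unfold rot_domain in Hp. fold (radius p) in Hp.
  specialize (HT xi ltac:(lra)). replace (x0 + xi) with (x1 p) in HT by (unfold xi; ring).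
  assert (Hmain : c0 * S2 - / 2 * (g2 + N ^ 3 * eps / 2) * xi ^ 2 < N * t).
  { replace (N * t) with (P * xi - et) by (unfold t; field; lra). lra. }
  replace (g2 + N ^ 3 * eps / 2) with (- N ^ 3 * (a + eps / 2)) in Hmain.
  2:{ replace (a + eps / 2) with (- g2 / N ^ 3 - eps / 2) by lra. field. lra. }
  unfold support. fold xi et. fold s t S2.
  enough (/ 2 * a * s ^ 2 + / 2 * b * S2 < t) by lra.
  apply (tangential_absorb a b eps P s t S2 d); auto.
  apply Rmult_lt_reg_l with N; [easy|].
  replace (N * (/ 2 * (b + eps / 2) * S2 + / 2 * (a + eps / 2) * (s + P * t) ^ 2))
    with (c0 * S2 - / 2 * (- N ^ 3 * (a + eps / 2)) * xi ^ 2)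
    by (rewrite <- Exi; unfold c0; field).
  exact Hmain.
Qed.

Lemma support_le x0 y0 P N a b p :
  0 < N -> N * N = 1 + P ^ 2 -> dist4 p (mkR4 x0 y0 0 0) < 1 ->
  support x0 y0 P N a b p <= (1 + Rabs a + Rabs b) * dist4 p (mkR4 x0 y0 0 0).
Proof.
  intros HN HNN. set (q := mkR4 x0 y0 0 0). set (d := dist4 p q). intros Hd.
  assert (Hd0 : 0 <= d) by apply dist4_pos.
  unfold support. set (xi := x1 p - x0). set (et := x2 p - y0).
  set (S2 := x3 p ^ 2 + x4 p ^ 2). set (s := (xi + P * et) / N). set (t := (P * xi - et) / N).
  assert (Hdd : xi ^ 2 + et ^ 2 + S2 = d * d).
  { unfold d. rewrite <- sqdist_dist4. unfold xi, et, S2, sqdist, q, dot4; cbn. ring. }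
  assert (HS0 : 0 <= S2) by (unfold S2; nra).
  assert (Est : s ^ 2 + t ^ 2 = xi ^ 2 + et ^ 2).
  { transitivity ((1 + P ^ 2) * (xi ^ 2 + et ^ 2) / (N * N)); [unfold s, t; field; lra|].
    rewrite HNN. field. nra. }
  pose proof (pow2_ge_0 s). pose proof (pow2_ge_0 t). pose proof (pow2_ge_0 xi).
  pose proof (pow2_ge_0 et). pose proof (Rabs_pos a). pose proof (Rabs_pos b).
  assert (Ht : t <= d) by nra.
  assert (Hs2 : s ^ 2 <= d) by nra. assert (HS2 : S2 <= d) by nra.
  assert (- a * s ^ 2 <= Rabs a * d).
  { apply Rle_trans with (Rabs a * s ^ 2); [|now apply Rmult_le_compat_l].
    apply Rmult_le_compat_r; [easy|]. rewrite <- Rabs_Ropp. apply Rle_abs. }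
  assert (- b * S2 <= Rabs b * d).
  { apply Rle_trans with (Rabs b * S2); [|now apply Rmult_le_compat_l].
    apply Rmult_le_compat_r; [easy|]. rewrite <- Rabs_Ropp. apply Rle_abs. }
  assert (0 <= Rabs a * d) by now apply Rmult_le_pos.
  assert (0 <= Rabs b * d) by now apply Rmult_le_pos.
  lra.
Qed.

Lemma cont4_support x0 y0 P N a b p : 0 < N -> cont4 (support x0 y0 P N a b) p.
Proof.
  intros HN. unfold support.
  repeat first [cont4_step | apply Rgt_not_eq; easy].
Qed.

Lemma rot_domain_slab g : continuity g -> (forall x, 0 < g x) ->
  exists S, forall p, rot_domain g p -> x1 p ^ 2 < 4 -> dot4 p p <= S.
Proof.
  intros Hg Hpos. destruct (continuity_ab_maj g (-2) 2) as (m & Hm & _); [lra|auto|].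
  exists (4 + g m * g m). intros p Hp Hx.
  unfold rot_domain in Hp. fold (radius p) in Hp.
  assert (g (x1 p) <= g m) by (apply Hm; nra).
  pose proof (radius_pos p). pose proof (radius_sqr p) as E.
  replace (dot4 p p) with (x1 p ^ 2 + radius p * radius p) by (rewrite E; unfold dot4; ring).
  nra.
Qed.

Lemma mean_convex_complement g g1 g2 U Du :
  (forall x, 0 < g x) -> (forall x, derivable_pt_lim g x (g1 x)) ->
  (forall x, derivable_pt_lim g1 x (g2 x)) -> roof (rot_domain g) U Du ->
  forall x, 2 * (1 + g1 x ^ 2) <= g x * g2 x.
Proof.
  intros Hpos Hg Hg1 HU x0. apply Rnot_lt_le; intros Hlt.
  assert (Hc : continuity g).
  { intros x. apply derivable_continuous_pt. exists (g1 x). apply Hg. }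
  destruct (rot_domain_slab g Hc Hpos) as (S & HS).
  set (y0 := g x0) in *. set (P := g1 x0) in *. assert (Hy : 0 < y0) by apply Hpos.
  set (N := sqrt (1 + P ^ 2)).
  assert (HP : 0 < 1 + P ^ 2) by nra.
  assert (HNN : N * N = 1 + P ^ 2) by (apply sqrt_sqrt; lra).
  assert (HN : 0 < N) by now apply sqrt_lt_R0.
  (* The sum of the principal curvatures of the boundary: one from the profile and, twice, that of
     the rotation. *)
  set (H := - g2 x0 / N ^ 3 + 2 * / (y0 * N)).
  assert (HH : 0 < H).
  { replace H with ((2 * (N * N) - y0 * g2 x0) / (y0 * N ^ 3)) by (unfold H; field; lra).
    rewrite HNN. apply Rdiv_lt_0_compat; [lra|]. apply Rmult_lt_0_compat; [easy|now apply pow_lt]. }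
  (* Three curvatures are lowered by [eps], so [a + 2 * b = H / 2] stays positive. *)
  set (eps := H / 6). assert (He : 0 < eps) by (unfold eps; lra).
  set (a := - g2 x0 / N ^ 3 - eps). set (b := / (y0 * N) - eps).
  destruct (support_positive g g1 (g2 x0) x0 Hpos Hg (Hg1 x0) N a b eps HN HNN He)
    as (rho & Hrho & Hsup); [unfold a; ring|unfold b, y0; ring|].
  fold y0 P in Hsup. set (q := mkR4 x0 y0 0 0) in *.
  assert (Hb : boundary4 (rot_domain g) q) by now apply rot_domain_bdry_point.
  assert (Hq : radius q = y0).
  { unfold radius, q; cbn [x2 x3 x4].
    replace (y0 ^ 2 + 0 ^ 2 + 0 ^ 2) with (y0 * y0) by ring. apply sqrt_square. lra. }
  set (n := mkR4 (P / N) (- / N) 0 0).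
  assert (Hn : outward_unit_normal (rot_domain g) q (scal4 (-1) n)).
  { replace (scal4 (-1) n) with (rot_normal q P).
    - apply rot_domain_normal; [exact Hq|now rewrite Hq|apply Hg].
    - unfold rot_normal. rewrite Hq. fold N. unfold n, q. apply R4_eq; cbn; field; lra. }
  assert (Hz : ~ rot_domain g q)
    by (apply boundary4_notin; [now apply rot_domain_open|easy]).
  apply (no_superharmonic_support (rot_domain g) U Du S q q n
    (support x0 y0 P N a b) (a + 2 * b) (Rmin rho 1) (1 + Rabs a + Rabs b)); auto.
  - intros p. now apply cont4_support.
  - intros p t. unfold support, n; cbn [x1 x2 x3 x4 add4 scal4].
    replace (x1 p + t * (P / N) - x0 + P * (x2 p + t * - / N - y0))
      with (x1 p - x0 + P * (x2 p - y0)) by (field; lra).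
    replace (P * (x1 p + t * (P / N) - x0) - (x2 p + t * - / N - y0))
      with (P * (x1 p - x0) - (x2 p - y0) + t * (1 + P ^ 2) / N) by (field; lra).
    rewrite <- HNN. field. lra.
  - unfold support, q; cbn. field. lra.
  - unfold a, b, eps, H. unfold H in HH. lra.
  - intros p. now apply lap_support.
  - apply Rmin_pos; lra.
  - pose proof (Rabs_pos a). pose proof (Rabs_pos b). lra.
  - intros p Hp. apply support_le; auto. eapply Rlt_le_trans; [exact Hp|apply Rmin_r].
  - intros p Hp Hd. apply Hsup; [easy|]. eapply Rlt_le_trans; [exact Hd|apply Rmin_l].
Qed.

(* [g'/g^2] is increasing, so [-1/g] grows at least linearly although it is negative. *)
Lemma no_global_solution g g1 g2 :
  (forall x, 0 < g x) -> even_fun g -> (forall x, derivable_pt_lim g x (g1 x)) ->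
  (forall x, derivable_pt_lim g1 x (g2 x)) ->
  ~ forall x, 2 * (1 + g1 x ^ 2) <= g x * g2 x.
Proof.
  intros Hpos Hev Hg Hg1 H.
  assert (H0 : g1 0 = 0).
  { assert (X : derivable_pt_lim g 0 (- g1 0)).
    { apply is_derive_Reals. apply is_derive_ext with (fun x => g (- x)); [exact Hev|].
      replace (- g1 0) with (-1 * g1 0) by ring.
      apply (is_derive_comp g (fun x => - x)).
      - rewrite Ropp_0. now apply is_derive_Reals.
      - auto_derive; [easy|ring]. }
    pose proof (uniqueness_limite _ _ _ _ (Hg 0) X). lra. }
  assert (Hg2 : forall x, 0 < g2 x).
  { intros x. specialize (H x). specialize (Hpos x). pose proof (pow2_ge_0 (g1 x)). nra. }
  assert (Hpos1 : 0 < g1 1).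
  { destruct (MVT_cor2 g1 g2 0 1) as (c & E & _); [lra|auto|].
    specialize (Hg2 c). lra. }
  set (h := fun x => g1 x / g x ^ 2).
  assert (Dh : forall x, derivable_pt_lim h x ((g x * g2 x - 2 * g1 x ^ 2) / g x ^ 3)).
  { intros x. specialize (Hpos x).
    apply is_derive_Reals. unfold h.
    pose proof (proj2 (is_derive_Reals g x _) (Hg x)) as D1.
    pose proof (proj2 (is_derive_Reals g1 x _) (Hg1 x)) as D2.
    auto_derive.
    - repeat split; [now exists (g2 x)|now exists (g1 x)|]. nra.
    - replace (Derive (fun y => g y) x) with (g1 x) by (symmetry; now apply is_derive_unique).
      replace (Derive (fun y => g1 y) x) with (g2 x) by (symmetry; now apply is_derive_unique).
      field. lra. }
  set (k := h 1).
  assert (Hk : 0 < k).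
  { apply Rdiv_lt_0_compat; [easy|]. apply pow_lt, Hpos. }
  assert (Hmono : forall x, 1 < x -> k <= h x).
  { intros x Hx. destruct (MVT_cor2 h (fun x => (g x * g2 x - 2 * g1 x ^ 2) / g x ^ 3) 1 x)
      as (c & E & _); [lra|auto|].
    assert (0 < (g c * g2 c - 2 * g1 c ^ 2) / g c ^ 3).
    { apply Rdiv_lt_0_compat; [|apply pow_lt, Hpos]. specialize (H c). lra. }
    unfold k. nra. }
  (* The point where the lower bound [- / g 1 + k * (x - 1)] for [- / g x] reaches zero. *)
  set (x := 1 + / (k * g 1)).
  assert (Hkg : 0 < k * g 1) by (apply Rmult_lt_0_compat; [easy|apply Hpos]).
  assert (Hx : 1 < x).
  { unfold x. assert (0 < / (k * g 1)) by now apply Rinv_0_lt_compat. lra. }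
  destruct (MVT_cor2 (fun x => - / g x) h 1 x) as (c & E & Hc); [lra| |].
  { intros z _. specialize (Hpos z). apply is_derive_Reals. unfold h.
    pose proof (proj2 (is_derive_Reals g z _) (Hg z)) as D1.
    auto_derive.
    - repeat split; [now exists (g1 z)|lra].
    - replace (Derive (fun y => g y) z) with (g1 z) by (symmetry; now apply is_derive_unique).
      field. lra. }
  specialize (Hmono c ltac:(lra)).
  assert (Ek : k * (x - 1) = / g 1).
  { unfold x. field. split; [pose proof (Hpos 1)|]; lra. }
  assert (k * (x - 1) <= h c * (x - 1)) by (apply Rmult_le_compat_r; lra).
  assert (0 < / g x) by apply Rinv_0_lt_compat, Hpos. lra.
Qed.

Theorem theorem8p1 (g : R -> R)
  (Hpos : forall x, 0 < g x) (Heven : even_fun g) (Han : real_analytic g) :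
  ~ exceptional (rot_domain g).
Proof.
  intros (u & Hu).
  destruct (real_analytic_C2 g Han) as (g1 & g2 & Hg & Hg1).
  assert (Hc : continuity g).
  { intros x. apply derivable_continuous_pt. exists (g1 x). apply Hg. }
  destruct (roof_of_roof_function (rot_domain g) u) as (U & Du & HU); [| |easy|].
  - now apply rot_domain_open.
  - intros q Hq. assert (E := rot_domain_boundary g q Hc Hq).
    exists (rot_normal q (g1 (x1 q))). apply rot_domain_normal; auto. rewrite E. apply Hpos.
  - apply (no_global_solution g g1 g2); auto.
    now apply (mean_convex_complement g g1 g2 U Du).
Qed.
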